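(* Let $p$ be hyperbolic with respect to $e\in\mathbb{R}^n$ and let $d=\deg(p)$ with $d>3$. Suppose that the hyperbolicity cone $\Lambda_+(p,e)$ is pointed and Terracini convex, and that $\mathrm{rank}_p(x)=1$ whenever $x$ generates an extreme ray of $\Lambda_+(p,e)$. If $\ell$ is an integer with $1\leq\ell\leq d-3$ and $e^{(1)},\ldots,e^{(\ell)}\in\Lambda_{++}(p,e)$, then $\Lambda_+(D_{e^{(\ell)}}D_{e^{(\ell-1)}}\cdots D_{e^{(1)}}p,\,e)$ is $(d-\ell-2)$-Terracini convex.
   Context: A real polynomial $p$, homogeneous of degree $d$ in $n$ variables, is hyperbolic with respect to $e\in\mathbb{R}^n$ if $p(e)>0$ and for each $x\in\mathbb{R}^n$ the univariate polynomial $t\mapsto p(te-x)$ has only real roots. These roots (with multiplicity) are the hyperbolic eigenvalues of $x$. $\mathrm{rank}_p(x)$ is the number of nonzero hyperbolic eigenvalues of $x$. The closed hyperbolicity cone $\Lambda_+(p,e)$ is the set of $x$ all of whose hyperbolic eigenvalues are nonnegative (a closed convex cone), and $\Lambda_{++}(p,e)$ is its interior. $D_{u}p(x)=\frac{d}{dt}p(x+tu)\big|_{t=0}$ is the directional derivative; for $u\in\Lambda_{++}(p,e)$, $D_up$ is again hyperbolic with respect to $e$ and $\Lambda_+(D_up,e)\supseteq\Lambda_+(p,e)$. Terracini convexity: for a closed, pointed ($\mathcal{C}\cap(-\mathcal{C})=\{0\}$), convex cone $\mathcal{C}$ and $x\in\mathcal{C}$, let $\mathcal{T}_{\mathcal{C}}(x)=\overline{\mathrm{cone}\{z-x:z\in\mathcal{C}\}}$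 be the tangent cone and $\mathcal{L}_{\mathcal{C}}(x)=\mathcal{T}_{\mathcal{C}}(x)\cap(-\mathcal{T}_{\mathcal{C}}(x))$ the convex tangent space. $\mathcal{C}$ is $k$-Terracini convex if $\mathcal{L}_{\mathcal{C}}\big(\sum_{i=1}^kx^{(i)}\big)=\sum_{i=1}^k\mathcal{L}_{\mathcal{C}}(x^{(i)})$ for any collection $x^{(1)},\ldots,x^{(k)}$ of (not necessarily distinct) generators of extreme rays of $\mathcal{C}$; it is Terracini convex if it is $k$-Terracini convex for all $k$. *)

(* Defs.v *)
From HB Require Import structures.
From mathcomp Require Import all_boot all_order all_algebra.
(* mpoly must be imported before the topology files: their notations clash
   when they come in the opposite order. *)
From mathcomp Require Import mpoly.
From mathcomp Require Import polyrcf complex.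
From mathcomp Require Import boolp classical_sets reals topology normedtype
  convex.

Set Implicit Arguments.
Unset Strict Implicit.
Unset Printing Implicit Defensive.

Import Order.TTheory GRing.Theory Num.Theory.
Import numFieldNormedType.Exports.

Local Open Scope classical_set_scope.
Local Open Scope ring_scope.

Section Hyperbolic.
Context {R : realType} {n : nat}.
Implicit Types (p : {mpoly R[n]}) (e u x : 'rV[R]_n) (d : nat).

(* The univariate polynomial t |-> p(t e - x). *)
Definition hyp_charpoly p e x : {poly R} :=
  mmap polyC (fun i => e 0 i *: 'X - (x 0 i)%:P) p.

Definition hyperbolic d p e : Prop :=
  [/\ p \is d.-homog,
      0 < p.@[fun i => e 0 i] &
      forall x (z : R[i]),
        root (map_poly (real_complex R) (hyp_charpoly p e x)) z ->
        complex.Im z = 0].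

(* Each eigenvalue is listed as many times as its multiplicity. *)
Definition hyp_eigenvalues p e x : seq R :=
  let q := hyp_charpoly p e x in
  flatten [seq nseq (mup a q) a | a <- rootsR q].

Definition hyp_rank p e x : nat :=
  count (fun a => a != 0) (hyp_eigenvalues p e x).

Definition hyp_cone p e : set 'rV[R]_n :=
  [set x | forall a, a \in hyp_eigenvalues p e x -> 0 <= a].

Definition hyp_open_cone p e : set 'rV[R]_n := interior (hyp_cone p e).

(* p(x + t u) is formed in {poly {mpoly R[n]}}, with t the outer variable,
   and its derivative in t is evaluated at t = 0. *)
Definition dirder u p : {mpoly R[n]} :=
  (mmap (fun c => (c%:MP)%:P) (fun i => ('X_i)%:P + (u 0 i)%:MP *: 'X) p)^`().[0].

(* For s = [:: u_1; ...; u_l] this is D_{u_l} ... D_{u_1} p. *)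
Definition iter_dirder (s : seq 'rV[R]_n) p : {mpoly R[n]} :=
  foldl (fun q u => dirder u q) p s.

End Hyperbolic.

Section Terracini.
Context {R : realType} {n : nat}.
Implicit Types (C S : set 'rV[R]_n) (x : 'rV[R]_n) (k : nat).

Definition conic_hull S : set 'rV[R]_n :=
  [set y | exists m (a : 'I_m -> R) (z : 'I_m -> 'rV[R]_n),
     (forall i, 0 <= a i /\ S (z i)) /\ y = \sum_(i < m) a i *: z i].

Definition tangent_cone C x : set 'rV[R]_n :=
  closure (conic_hull [set z - x | z in C]).

Definition convex_tangent_space C x : set 'rV[R]_n :=
  tangent_cone C x `&` [set - y | y in tangent_cone C x].

Definition pointed C : Prop := C `&` [set - y | y in C] = [set 0].

Definition closed_convex_cone C : Prop :=
  [/\ closed C, convex_set C, C 0 & forall (a : R) x, 0 <= a -> C x -> C (a *: x)].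

Definition ray x : set 'rV[R]_n := [set a *: x | a in [set a : R | 0 <= a]].

(* x generates an extreme ray of C: the ray of x is a face of C. *)
Definition extreme_ray_generator C x : Prop :=
  [/\ C x, x != 0 &
      forall y z, C y -> C z -> ray x (y + z) -> ray x y /\ ray x z].

Definition minkowski_sum k (A : 'I_k -> set 'rV[R]_n) : set 'rV[R]_n :=
  [set y | exists2 z : 'I_k -> 'rV[R]_n,
     (forall i, A i (z i)) & y = \sum_(i < k) z i].

(* The notion is only defined for closed pointed convex cones, so being such a
   cone is part of the predicate. *)
Definition k_terracini_convex k C : Prop :=
  [/\ closed_convex_cone C, pointed C &
      forall x : 'I_k -> 'rV[R]_n,
        (forall i, extreme_ray_generator C (x i)) ->
        convex_tangent_space C (\sum_(i < k) x i) =
        minkowski_sum (fun i => convex_tangent_space C (x i))].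

Definition terracini_convex C : Prop :=
  forall k, (0 < k)%N -> k_terracini_convex k C.

End Terracini.

(* Main.v *)
(* Write q for the iterated derivative and m = d - l for its degree. Garding's theorem
   (every direction in the open cone is again a direction of hyperbolicity, and
   the open cone is convex) is obtained by a homotopy: the complex roots move
   continuously and cannot cross the real axis. Together with Gauss-Lucas it makes
   the derivatives hyperbolic.

   For y in the cone of q let the multiplicity of y be the order of vanishing of q
   at y. If it is at least 2, then y already lies in the cone of p, the
   multiplicity at y for p is larger by l, and both cones have the same convex
   tangent space at y. If it is 1, the convex tangent space of the cone of q is a
   hyperplane supporting that cone, and if it is 0, the whole space.

   So let k = m - 2 extreme rays of the cone of q be given. If some generator has
   multiplicity at most 1, its tangent space is a supporting hyperplane or
   everything, and the identity of tangent spaces is elementary. Otherwise all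
   generators span extreme rays of the cone of p, hence have rank 1; by
   subadditivity of the rank their sum still has multiplicity at least 2 for q,
   so every tangent space in the identity may be computed in the cone of p. *)

Require Import Defs.
From mathcomp Require Import all_boot all_order all_algebra.
From mathcomp Require Import ring lra zify.
From mathcomp Require Import mpoly.
From mathcomp Require Import polyrcf complex.
From mathcomp Require Import boolp classical_sets reals interval_inference topology normedtype
  convex.

Set Implicit Arguments.
Unset Strict Implicit.
Unset Printing Implicit Defensive.

Import Order.TTheory GRing.Theory Num.Theory.
Import numFieldNormedType.Exports.

Local Open Scope classical_set_scope.
Local Open Scope ring_scope.

(** * Restriction of a multivariate polynomial to a line *)

Section Lines.
Context {K : comNzRingType} {n : nat}.
Implicit Types (p q : {mpoly K[n]}) (a b : 'rV[K]_n).

(** Serves to check identities between ring morphisms out of [{mpoly K[n]}], and the chain rule, on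
    constants and variables only. *)
Lemma mpoly_ring_ind (P : {mpoly K[n]} -> Prop) :
    (forall c, P c%:MP) -> (forall i, P 'X_i) ->
    (forall p q, P p -> P q -> P (p + q)) ->
    (forall p q, P p -> P q -> P (p * q)) ->
  forall p, P p.
Proof.
move=> PC PX PD PM p; rewrite (mpolyE p).
apply: (big_ind P) => [||m _]; [by rewrite -mpolyC0 | exact: PD |].
rewrite -mul_mpolyC; apply: (PM) => //; rewrite mpolyXE_id.
apply: (big_ind P) => [||i _]; [by rewrite -mpolyC1 | exact: PM |].
elim: (m i) => [|k IH]; first by rewrite expr0 -mpolyC1.
by rewrite exprS; apply: (PM).
Qed.

Definition ev p a : K := p.@[fun i => a 0 i].

Definition line p a b : {poly K} :=
  mmap polyC (fun i => (a 0 i)%:P + b 0 i *: 'X) p.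

Lemma horner_line p a b t : (line p a b).[t] = ev p (a + t *: b).
Proof.
rewrite /line /ev; elim/mpoly_ring_ind: p => [c|i|p q IHp IHq|p q IHp IHq].
- by rewrite mmapC hornerC mevalC.
- by rewrite mmapX mmap1U mevalXU !mxE !hornerE [b 0 i * t]mulrC.
- by rewrite rmorphD hornerD IHp IHq mevalD.
- by rewrite rmorphM hornerM IHp IHq mevalM.
Qed.

Lemma coef0_line p a b : (line p a b)`_0 = ev p a.
Proof. by rewrite -horner_coef0 horner_line scale0r addr0. Qed.

Lemma ev_homogZ d p c a : p \is d.-homog -> ev p (c *: a) = c ^+ d * ev p a.
Proof.
move=> /dhomogP hp; rewrite /ev !mevalE mulr_sumr [LHS]big_seq [RHS]big_seq.
apply: eq_bigr => m /hp /= <-; rewrite mulrCA; congr (_ * _).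
rewrite mdegE -prodrXr -big_split /=.
by apply: eq_bigr => i _; rewrite !mxE exprMn.
Qed.

Lemma size_line d p a b : p \is d.-homog -> (size (line p a b) <= d.+1)%N.
Proof.
move=> /dhomogP hp; rewrite /line /mmap big_seq.
apply: (big_ind (fun r : {poly K} => (size r <= d.+1)%N)).
- by rewrite size_poly0.
- by move=> r s hr hs; rewrite (leq_trans (size_polyD _ _)) // geq_max hr.
move=> m /hp /= <-; rewrite mul_polyC (leq_trans (size_scale_leq _ _)) //.
rewrite mdegE /mmap1.
elim/big_ind2: _ => [|r k s l hr hs|i _]; first by rewrite size_poly1.
- rewrite (leq_trans (size_polyMleq _ _)) //; rewrite -subn1 leq_subLR.
  by rewrite add1n -addSn -addnS leq_add.
elim: (m i) => [|k IH]; first by rewrite expr0 size_poly1.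
rewrite exprS (leq_trans (size_polyMleq _ _)) // -subn1 leq_subLR add1n.
rewrite -[k.+3]/(2 + k.+1)%N leq_add //.
rewrite (leq_trans (size_polyD _ _)) // geq_max (leq_trans (size_polyC_leq1 _)) //=.
by rewrite (leq_trans (size_scale_leq _ _)) // size_polyX.
Qed.

(** Chain rule. The ring [S] is kept abstract so that one proof serves both [line] and [dirder],
    where [S] is itself a polynomial ring. *)
Lemma deriv_mmap (S : comNzRingType) (f : {rmorphism K -> {poly S}})
    (k : 'I_n -> {poly S}) p : (forall c, (f c)^`() = 0) ->
  (mmap f k p)^`() = \sum_i mmap f k p^`M(i) * (k i)^`().
Proof.
move=> f0; elim/mpoly_ring_ind: p => [c|j|p q IHp IHq|p q IHp IHq].
- by rewrite mmapC f0 big1 // => i _; rewrite mderivC rmorph0 mul0r.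
- rewrite mmapX mmap1U (bigD1 j) //= big1 => [|i /negPf ij].
    rewrite addr0 mderivX mnmE eqxx scale1r.
    have -> : (U_(j) - U_(j) = 0 :> 'X_{1..n})%MM.
      by apply/mnmP => i; rewrite mnmBE subnn mnm0E.
    by rewrite mmapX mmap11 mul1r.
  by rewrite mderivX mnmE eq_sym ij scale0r rmorph0 mul0r.
- rewrite rmorphD derivD IHp IHq -big_split /=.
  by apply: eq_bigr => i _; rewrite mderivD rmorphD mulrDl.
- rewrite rmorphM derivM IHp IHq mulr_suml mulr_sumr -big_split /=.
  apply: eq_bigr => i _; rewrite mderivM rmorphD !rmorphM mulrDl.
  by rewrite -!mulrA; congr (_ + _); rewrite [_^`() * _]mulrC.
Qed.

Lemma deriv_mmap_horner0 (S : comNzRingType) (f : {rmorphism K -> {poly S}})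
    (g : {rmorphism K -> S}) (k : 'I_n -> {poly S}) (h : 'I_n -> S) p :
    (forall c, (f c)^`() = 0) -> (forall c, (f c).[0] = g c) ->
    (forall i, (k i).[0] = h i) ->
  (mmap f k p)^`().[0] = \sum_i mmap g h p^`M(i) * (k i)^`().[0].
Proof.
move=> f0 fg kh.
have E q : (mmap f k q).[0] = mmap g h q.
  elim/mpoly_ring_ind: q => [c|j|q r IHq IHr|q r IHq IHr].
  - by rewrite !mmapC fg.
  - by rewrite !mmapX !mmap1U kh.
  - by rewrite !rmorphD hornerD IHq IHr.
  - by rewrite !rmorphM hornerM IHq IHr.
rewrite deriv_mmap // horner_sum.
by apply: eq_bigr => i _; rewrite hornerM E.
Qed.

Lemma deriv_line p a b :
  (line p a b)^`() = \sum_i b 0 i *: line p^`M(i) a b.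
Proof.
rewrite deriv_mmap; last by move=> c; rewrite derivC.
apply: eq_bigr => i _.
by rewrite derivD derivC add0r derivZ derivX -mul_polyC mulr1 mulrC mul_polyC.
Qed.

Lemma coef1_line p a b : (line p a b)`_1 = \sum_i b 0 i * ev p^`M(i) a.
Proof.
rewrite -[LHS]mulr1n -coef_deriv deriv_line coef_sum.
by apply: eq_bigr => i _; rewrite coefZ coef0_line.
Qed.

Lemma mderiv_homog d p i : p \is d.-homog -> p^`M(i) \is d.-1.-homog.
Proof.
move=> /dhomogP hp; apply/dhomogP => m; rewrite mcoeff_msupp mcoeff_mderiv => h.
have /hp : (m + U_(i))%MM \in msupp p.
  by rewrite mcoeff_msupp; apply/eqP => h0; move: h; rewrite h0 mul0rn eqxx.
by move=> /= <-; rewrite mdegD mdeg1 addn1.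
Qed.

End Lines.

Lemma map_mderiv (K L : comNzRingType) (f : {rmorphism K -> L}) n
    (p : {mpoly K[n]}) i :
  map_mpoly f p^`M(i) = (map_mpoly f p)^`M(i).
Proof.
apply/mpolyP => m.
by rewrite mcoeff_map_mpoly !mcoeff_mderiv mcoeff_map_mpoly raddfMn.
Qed.

Lemma map_homog (K L : comNzRingType) (f : {rmorphism K -> L}) n d
    (p : {mpoly K[n]}) : p \is d.-homog -> map_mpoly f p \is d.-homog.
Proof.
move=> /dhomogP hp; apply/dhomogP => m; rewrite mcoeff_msupp mcoeff_map_mpoly => h.
by apply: hp; rewrite mcoeff_msupp; apply: contraNneq h => ->; rewrite raddf0.
Qed.

Lemma map_line (K L : comNzRingType) (f : {rmorphism K -> L}) n
    (p : {mpoly K[n]}) a b :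
  map_poly f (line p a b) = line (map_mpoly f p) (map_mx f a) (map_mx f b).
Proof.
rewrite /line; elim/(@mpoly_ring_ind K n): p => [e|i|p q IHp IHq|p q IHp IHq].
- by rewrite mmapC map_mpolyC mmapC map_polyC.
- rewrite mmapX mmap1U map_mpolyX mmapX mmap1U !mxE.
  by rewrite rmorphD /= map_polyC /= map_polyZ map_polyX.
- by rewrite !rmorphD /= IHp IHq.
- by rewrite !rmorphM /= IHp IHq.
Qed.

(** * Directional derivatives through partial derivatives *)

Section DirectionalDerivative.
Context {R : realType} {n : nat}.
Implicit Types (p : {mpoly R[n]}) (a b u : 'rV[R]_n).

Lemma dirderE u p : dirder u p = \sum_i u 0 i *: p^`M(i).
Proof.
pose f : {rmorphism R -> {poly {mpoly R[n]}}} := (polyC \o @mpolyC n R).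
pose k (i : 'I_n) : {poly {mpoly R[n]}} := ('X_i)%:P + (u 0 i)%:MP *: 'X.
have -> : dirder u p = (mmap f k p)^`().[0] by [].
rewrite (@deriv_mmap_horner0 R n _ f (@mpolyC n R) k (fun i => 'X_i)).
- apply: eq_bigr => i _; rewrite /k derivD derivC add0r derivZ derivX hornerZ.
  rewrite hornerC mulr1 mulrC mul_mpolyC; congr (_ *: _).
  rewrite [RHS]mpolyE; apply: eq_bigr => m _.
  by rewrite mul_mpolyC mmap1_id.
- by move=> c; rewrite derivC.
- by move=> c; rewrite hornerC.
- by move=> i; rewrite /k hornerD hornerC hornerZ hornerX mulr0 addr0.
Qed.

Lemma dirder_homog d u p : p \is d.-homog -> dirder u p \is d.-1.-homog.
Proof.
by move=> hp; rewrite dirderE rpred_sum // => i _; rewrite rpredZ // mderiv_homog.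
Qed.

Lemma deriv_line_dirder p a u : (line p a u)^`() = line (dirder u p) a u.
Proof.
rewrite deriv_line dirderE /line rmorph_sum /=.
by apply: eq_bigr => i _; rewrite mmapZ mul_polyC.
Qed.

Lemma ev_dirder p a u : ev (dirder u p) a = (line p a u)`_1.
Proof. by rewrite -(coef0_line _ a u) -deriv_line_dirder coef_deriv mulr1n. Qed.

Lemma ev_dirderD p a u v : ev (dirder (u + v) p) a = ev (dirder u p) a + ev (dirder v p) a.
Proof.
rewrite !ev_dirder !coef1_line -big_split /=.
by apply: eq_bigr => i _; rewrite mxE mulrDl.
Qed.

Lemma ev_dirderZ p a c u : ev (dirder (c *: u) p) a = c * ev (dirder u p) a.
Proof.
rewrite !ev_dirder !coef1_line mulr_sumr.
by apply: eq_bigr => i _; rewrite mxE mulrA.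
Qed.

Lemma ev_dirderN p a u : ev (dirder (- u) p) a = - ev (dirder u p) a.
Proof. by rewrite -scaleN1r ev_dirderZ mulN1r. Qed.

End DirectionalDerivative.

(** * Degree reversal and leading coefficients on a line *)

Section LeadingCoefficient.
Context {K : numFieldType} {n : nat}.
Implicit Types (p : {mpoly K[n]}) (a b : 'rV[K]_n).

(* Homogeneity: p(a + t b) = t^d p(b + t^-1 a). *)
Lemma coef_line_rev d p a b j : p \is d.-homog -> (j <= d)%N ->
  (line p a b)`_j = (line p b a)`_(d - j).
Proof.
move=> hp jd.
suff -> : line p a b = \poly_(i < d.+1) (line p b a)`_(d - i).
  by rewrite coef_poly ltnS jd.
apply/eqP; rewrite -subr_eq0; apply/eqP; set r := _ - _.
(* The difference [r] vanishes at the integers 1, ..., [size r], more roots than a nonzero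
   polynomial of that size can have. *)
apply: (@roots_geq_poly_eq0 _ r [seq i.+1%:R | i <- iota 0 (size r)]).
- apply/allP => _ /mapP[i _ ->]; rewrite rootE /r hornerD hornerN horner_poly.
  rewrite horner_line subr_eq0; apply/eqP.
  set t : K := _.+1%:R; have t0 : t != 0 by rewrite pnatr_eq0.
  have -> : a + t *: b = t *: (b + t^-1 *: a).
    by rewrite scalerDr scalerA mulfV // scale1r addrC.
  rewrite (ev_homogZ _ _ hp) -horner_line.
  rewrite (horner_coef_wide _ (size_line b a hp)) mulr_sumr.
  rewrite [RHS](reindex_inj rev_ord_inj) /=; apply: eq_bigr => i0 _.
  have i0d : (i0 <= d)%N by rewrite -ltnS.
  rewrite subSS subKn // mulrCA; congr (_ * _).
  have -> : t ^+ d = t ^+ (d - i0) * t ^+ i0 by rewrite -exprD subnK.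
  by rewrite exprVn mulfK // expf_neq0.
- rewrite map_inj_in_uniq ?iota_uniq // => x y _ _ /eqP.
  by rewrite eqr_nat eqSS => /eqP.
- by rewrite size_map size_iota.
Qed.

Lemma lead_line d p a b : p \is d.-homog -> (line p a b)`_d = ev p b.
Proof. by move=> hp; rewrite (coef_line_rev _ _ hp) // subnn coef0_line. Qed.

Lemma size_line_eq d p a b : p \is d.-homog -> ev p b != 0 ->
  size (line p a b) = d.+1.
Proof.
move=> hp b0; apply/eqP; rewrite eqn_leq size_line //=.
apply: contraNT b0; rewrite -ltnNge ltnS => h.
by rewrite -(lead_line a b hp) nth_default.
Qed.

Lemma lead_coef_line d p a b : p \is d.-homog -> ev p b != 0 ->
  lead_coef (line p a b) = ev p b.
Proof. by move=> hp b0; rewrite lead_coefE (size_line_eq _ hp) //= (lead_line _ _ hp). Qed.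

End LeadingCoefficient.

(** * Real-rooted polynomials *)

Lemma coef_XsubCM (K : comNzRingType) (r : K) (f : {poly K}) j :
  (('X - r%:P) * f)`_j = (if j is k.+1 then f`_k else 0) - r * f`_j.
Proof. by rewrite mulrBl coefB coefXM coefCM; case: j. Qed.

Section RealPolynomials.
Context {R : realFieldType}.
Implicit Types (f g : {poly R}) (rs : seq R).

Lemma horner_prod_XsubC rs t :
  (\prod_(r <- rs) ('X - r%:P)).[t] = \prod_(r <- rs) (t - r).
Proof. by rewrite horner_prod; apply: eq_bigr => r _; rewrite hornerXsubC. Qed.

Lemma prod_XsubC_coef_ge0 rs j : (forall r, r \in rs -> r <= 0) ->
  0 <= (\prod_(r <- rs) ('X - r%:P))`_j.
Proof.
elim: rs j => [|r rs IH] j h.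
  by rewrite big_nil coef1; case: (j == _).
have {}IH k : 0 <= (\prod_(r <- rs) ('X - r%:P))`_k.
  by apply: IH => x xr; apply: h; rewrite inE xr orbT.
rewrite big_cons coef_XsubCM -mulNr addr_ge0 //; first by case: j.
by rewrite mulr_ge0 // oppr_ge0 h // mem_head.
Qed.

Lemma prod_XsubC_coef_gt0 rs j : (forall r, r \in rs -> r < 0) ->
  (j <= size rs)%N -> 0 < (\prod_(r <- rs) ('X - r%:P))`_j.
Proof.
elim: rs j => [|r rs IH] j h.
  by rewrite leqn0 => /eqP ->; rewrite big_nil coef1.
have h' x : x \in rs -> x < 0 by move=> xr; apply: h; rewrite inE xr orbT.
have r0 : r < 0 by rewrite h // mem_head.
rewrite big_cons coef_XsubCM -mulNr => jle.
have p0 k : 0 <= (\prod_(r <- rs) ('X - r%:P))`_k.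
  by apply: prod_XsubC_coef_ge0 => x /h' /ltW.
case: j jle => [|j] jle.
  by rewrite add0r mulr_gt0 ?oppr_gt0 // IH.
by rewrite ltr_wpDr ?IH // mulr_ge0 // oppr_ge0 ltW.
Qed.

Definition laguerre f := f`_1 ^+ 2 - 2 * f`_0 * f`_2.

(* For f = c prod (X - r) this is f(0)^2 times the sum of the 1 / r^2. *)
Lemma laguerre_prod rs c (f := c *: \prod_(r <- rs) ('X - r%:P)) :
  0 <= laguerre f /\ forall r, r \in rs -> f`_0 ^+ 2 <= r ^+ 2 * laguerre f.
Proof.
rewrite /f {f}.
have E p : laguerre (c *: p) = c ^+ 2 * laguerre p.
  by rewrite /laguerre !coefZ; ring.
rewrite E coefZ exprMn.
suff [h1 h2] : 0 <= laguerre (\prod_(r <- rs) ('X - r%:P)) /\ forall r, r \in rs ->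
    (\prod_(r <- rs) ('X - r%:P))`_0 ^+ 2 <=
    r ^+ 2 * laguerre (\prod_(r <- rs) ('X - r%:P)).
  split=> [|r /h2 h]; first by rewrite mulr_ge0 // sqr_ge0.
  by rewrite [leRHS]mulrCA ler_wpM2l ?sqr_ge0.
elim: rs => [|r rs [IH1 IH2]].
  by rewrite big_nil /laguerre !coef1 /= !(mulr0, mul0r) expr0n subr0.
rewrite big_cons; set h := \prod_(_ <- _) _ in IH1 IH2 *.
have N : laguerre (('X - r%:P) * h) = h`_0 ^+ 2 + r ^+ 2 * laguerre h.
  by rewrite /laguerre !coef_XsubCM; ring.
have C : (('X - r%:P) * h)`_0 = - r * h`_0 by rewrite coef_XsubCM; ring.
rewrite N C; split=> [|x].
  by rewrite addr_ge0 ?sqr_ge0 // mulr_ge0 ?sqr_ge0.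
rewrite exprMn sqrrN mulrDr inE => /orP[/eqP ->|/IH2 h'].
  by rewrite lerDl mulr_ge0 ?sqr_ge0 // mulr_ge0 ?sqr_ge0.
apply: ler_wpDl; first by rewrite mulr_ge0 ?sqr_ge0.
by rewrite [leRHS]mulrCA ler_wpM2l ?sqr_ge0.
Qed.

Lemma poly_bound01 f : exists2 M, 0 <= M & forall s, 0 <= s <= 1 -> `|f.[s]| <= M.
Proof.
elim/poly_ind: f => [|f c [M M0 hM]].
  by exists 0; [exact: lexx | move=> s _; rewrite horner0 normr0].
exists (M + `|c|) => [|s /andP[s0 s1]]; first by rewrite addr_ge0.
rewrite hornerMXaddC (le_trans (ler_normD _ _)) // lerD2r normrM.
rewrite -[leRHS]mulr1; apply: ler_pM => //; first by rewrite hM ?s0.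
by rewrite ger0_norm.
Qed.

Lemma poly_gt0_near0 f : 0 < f`_0 ->
  exists2 d, 0 < d & forall s, 0 <= s <= d -> 0 < f.[s].
Proof.
elim/poly_ind: f => [|f c _]; first by rewrite !coef0 ltxx.
rewrite coefD coefMX coefC /= add0r => c0.
have [M M0 hM] := poly_bound01 f.
(* For these [s] the term [s * f.[s]] is at most [c / 2] in absolute value, so the constant term
   wins. *)
exists (Num.min 1 (c / (2 * (M + 1)))).
  by rewrite lt_min ltr01 divr_gt0 // mulr_gt0 // ltr_wpDl.
move=> s /andP[s0]; rewrite le_min => /andP[s1 sc].
have /hM/ler_normlP[h _] : 0 <= s <= 1 by rewrite s0 s1.
rewrite hornerMXaddC.
have sM : s * (2 * (M + 1)) <= c by rewrite -ler_pdivlMr // mulr_gt0 // ltr_wpDl.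
have : s * - f.[s] <= s * M by rewrite ler_wpM2l.
by nra.
Qed.

Lemma poly_gt0_right f : f`_0 = 0 -> 0 < f`_1 ->
  exists2 d, 0 < d & forall s, 0 < s <= d -> 0 < f.[s].
Proof.
elim/poly_ind: f => [|f c _]; first by rewrite !coef0 ltxx.
rewrite !coefD !coefMX !coefC /= add0r addr0 => -> /poly_gt0_near0[d d0 h].
exists d => // s /andP[s0 sd]; rewrite hornerMXaddC addr0 mulr_gt0 // h //.
by rewrite ltW.
Qed.

Lemma poly_ge0_limit f : (forall s, 0 < s -> 0 <= f.[s]) -> 0 <= f`_0.
Proof.
move=> h; rewrite leNgt; apply/negP => f0.
have /poly_gt0_near0[d d0 /(_ d)] : 0 < (- f)`_0 by rewrite coefN oppr_gt0.
rewrite lexx (ltW d0) hornerN oppr_gt0 => /(_ isT).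
by rewrite ltNge h.
Qed.

Definition nncoef f := forall j, 0 <= f`_j.

Lemma nncoef_horner_le f s t : (forall j, (0 < j)%N -> 0 <= f`_j) ->
  0 <= s <= t -> f.[s] <= f.[t].
Proof.
move=> hf /andP[s0 st]; rewrite !horner_coef; apply: ler_sum => j _.
case: (nat_of_ord j) => [|k]; first by rewrite !expr0.
by rewrite ler_wpM2l ?hf // lerXn2r ?nnegrE // (le_trans s0).
Qed.

Lemma nncoef_horner_ge f j t : nncoef f -> 0 <= t -> f`_j * t ^+ j <= f.[t].
Proof.
move=> hf t0; rewrite horner_coef.
have nn i : 0 <= f`_i * t ^+ i by rewrite mulr_ge0 ?exprn_ge0.
have [js|js] := ltnP j (size f); last by rewrite nth_default // mul0r sumr_ge0.
rewrite (bigD1 (Ordinal js)) //= lerDl sumr_ge0 // => i _; exact: nn.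
Qed.

Lemma nncoef_horner_ub f m T : nncoef f -> 0 <= T -> (forall j, (j < m)%N -> f`_j = 0) ->
  exists2 M, 0 <= M & forall t, 0 <= t <= T -> f.[t] <= M * t ^+ m.
Proof.
move=> hf T0 fm; have T1 : 1 <= 1 + T by rewrite lerDl.
have TT : 0 <= 1 + T by rewrite (le_trans ler01).
exists (\sum_(j < size f) f`_j * (1 + T) ^+ j).
  by rewrite sumr_ge0 // => j _; rewrite mulr_ge0 // exprn_ge0.
move=> t /andP[t0 tT]; rewrite horner_coef mulr_suml; apply: ler_sum => j _.
have [/fm ->|mj] := ltnP j m; first by rewrite !mul0r.
have -> : t ^+ j = t ^+ (j - m) * t ^+ m by rewrite -exprD subnK.
rewrite -mulrA ler_wpM2l // ler_wpM2r ?exprn_ge0 //.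
apply: (@le_trans _ _ ((1 + T) ^+ (j - m))); last by rewrite ler_weXn2l // leq_subr.
by rewrite lerXn2r ?nnegrE // (le_trans tT) // lerDr.
Qed.

(** From [f_j t^j <= M t^m <= (|M| + 1) t^(j+1)] one gets [f_j <= (|M| + 1) t], which fails for the
    small [t] below. With the converse [nncoef_horner_ub], orders of vanishing become growth rates
    and can be compared through inequalities between values. *)
Lemma nncoef_vanish f m M : nncoef f ->
    (forall t, 0 < t <= 1 -> f.[t] <= M * t ^+ m) ->
  forall j, (j < m)%N -> f`_j = 0.
Proof.
move=> hf h j jm; apply/eqP; rewrite eq_le hf andbT leNgt; apply/negP => fj.
have M0 : 0 < `|M| + 1 by rewrite ltr_wpDl.
pose t := Num.min 1 (f`_j / (2 * (`|M| + 1))).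
have t0 : 0 < t by rewrite lt_min ltr01 divr_gt0 // mulr_gt0.
have t1 : t <= 1 by rewrite ge_min lexx.
have tj : 0 < t ^+ j by rewrite exprn_gt0.
have := h t; rewrite t0 t1 => /(_ isT) /(le_trans (nncoef_horner_ge j hf (ltW t0))).
have tm : t ^+ m <= t ^+ j * t by rewrite -exprSr ler_wiXn2l // ltW.
have Mt : M * t ^+ m <= (`|M| + 1) * (t ^+ j * t).
  apply: (@le_trans _ _ ((`|M| + 1) * t ^+ m)); last by rewrite ler_wpM2l // ltW.
  rewrite ler_wpM2r ?exprn_ge0 ?(ltW t0) //.
  by rewrite (le_trans (ler_norm _)) // lerDl ler01.
have tM : t * (2 * (`|M| + 1)) <= f`_j.
  by rewrite -ler_pdivlMr ?mulr_gt0 // ge_min lexx orbT.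
by nra.
Qed.

End RealPolynomials.

(** * Homotopy of complex roots *)

Import ComplexField.Normc.

Section ComplexEstimates.
Context {R : realType}.
Local Notation C := R[i].
Implicit Types (z w : C) (rs : seq C).

Lemma normc_ge0 z : 0 <= normc z.
Proof. by case: z => a b; rewrite /normc sqrtr_ge0. Qed.

Lemma Im_le_normc z : `|complex.Im z| <= normc z.
Proof.
case: z => a b /=; rewrite -sqrtr_sqr ler_sqrt ?addr_ge0 ?sqr_ge0 //.
by rewrite lerDr sqr_ge0.
Qed.

Lemma normc_real (s : R) : normc s%:C%C = `|s|.
Proof. by rewrite /normc /= expr0n addr0 sqrtr_sqr. Qed.

Lemma normc_prod_ge rs z b : 0 <= b -> (forall w, w \in rs -> b <= complex.Im (z - w)) ->
  b ^+ size rs <= normc (\prod_(w <- rs) (z - w)).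
Proof.
move=> b0; elim: rs => [|w rs IH] h; first by rewrite big_nil normc1.
rewrite big_cons normcM exprS ler_pM ?exprn_ge0 //; last first.
  by apply: IH => x xr; apply: h; rewrite inE xr orbT.
by apply: le_trans (Im_le_normc _); rewrite (le_trans (h w _)) ?mem_head // ler_norm.
Qed.

(** Each factor satisfies [|z - w| >= - Im w] and [|z| <= |z - w| + |w|], hence dominates a multiple
    of [1 + |z|]. The bound holds on the whole unbounded half-plane, so no root can come in from
    infinity in the homotopy. *)
Lemma normc_prod_growth rs : (forall w, w \in rs -> complex.Im w < 0) ->
  exists2 k, 0 < k & forall z, 0 <= complex.Im z ->
    k * (1 + normc z) ^+ size rs <= normc (\prod_(w <- rs) (z - w)).
Proof.
elim: rs => [|w rs IH] h.
  by exists 1 => // z _; rewrite big_nil normc1 expr0 mulr1.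
have [|k k0 hk] := IH; first by move=> x xr; apply: h; rewrite inE xr orbT.
have w0 : complex.Im w < 0 by rewrite h ?mem_head.
pose D := - complex.Im w; have D0 : 0 < D by rewrite oppr_gt0.
have B0 : 0 < 1 + normc w + D by rewrite addr_gt0 // ltr_wpDr ?normc_ge0.
exists (D / (1 + normc w + D) * k) => [|z z0]; first by rewrite mulr_gt0 ?divr_gt0.
rewrite big_cons normcM exprS mulrACA; apply: ler_pM; last exact: hk.
- by rewrite !mulr_ge0 ?invr_ge0 ?addr_ge0 ?normc_ge0 // ltW.
- by rewrite mulr_ge0 ?exprn_ge0 ?addr_ge0 ?normc_ge0 // ltW.
rewrite mulrAC ler_pdivrMr //.
have h1 : D <= normc (z - w).
  apply: le_trans (Im_le_normc _); apply: le_trans (ler_norm _).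
  by case: z z0 => a b /=; case: w @D {D0 B0 h w0} => c e /=; rewrite lerDr.
have h2 : normc z <= normc (z - w) + normc w.
  by rewrite -{1}(subrK w z) le_normcD.
by have := normc_ge0 w; nra.
Qed.

(** Growth of degree [k] in [z], together with a Lipschitz bound in [s] carrying the same weight
    [(1 + |z|)^k]. The weight makes degrees add under products. *)
Definition lip k (g : R -> C -> C) := exists2 M, 0 <= M &
  forall s s' z, 0 <= s <= 1 -> 0 <= s' <= 1 ->
    normc (g s z) <= M * (1 + normc z) ^+ k /\
    normc (g s z - g s' z) <= M * `|s - s'| * (1 + normc z) ^+ k.

Lemma lipC c : lip 0 (fun _ _ => c).
Proof.
exists (normc c); first exact: normc_ge0.
by move=> s s' z _ _; rewrite !expr0 !mulr1 subrr normc0 mulr_ge0 ?normc_ge0.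
Qed.

Lemma lip_affine (a b v : C) : lip 1 (fun s z => a + s%:C%C * b + z * v).
Proof.
exists (normc a + normc b + normc v); first by rewrite !addr_ge0 ?normc_ge0.
move=> s s' z /andP[s0 s1] _; rewrite !expr1.
have na := normc_ge0 a; have nb := normc_ge0 b.
have nv := normc_ge0 v; have nz := normc_ge0 z.
split.
  have := le_normcD (a + s%:C%C * b) (z * v); have := le_normcD a (s%:C%C * b).
  rewrite !normcM normc_real ger0_norm //.
  by nra.
have -> : a + s%:C%C * b + z * v - (a + s'%:C%C * b + z * v) = (s - s')%:C%C * b.
  by rewrite rmorphB /=; ring.
rewrite normcM normc_real [leRHS]mulrAC mulrC ler_wpM2r //.
by nra.
Qed.

Lemma lipD k g h : lip k g -> lip k h -> lip k (fun s z => g s z + h s z).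
Proof.
move=> [M M0 hM] [N N0 hN]; exists (M + N); first exact: addr_ge0.
move=> s s' z hs hs'; have [h1 h2] := hM s s' z hs hs'.
have [h3 h4] := hN s s' z hs hs'; split.
  by rewrite mulrDl (le_trans (le_normcD _ _)) // lerD.
rewrite opprD addrACA (le_trans (le_normcD _ _)) //.
by rewrite !mulrDl lerD.
Qed.

Lemma lipM k l g h : lip k g -> lip l h -> lip (k + l) (fun s z => g s z * h s z).
Proof.
move=> [M M0 hM] [N N0 hN]; exists (2 * M * N); first by rewrite !mulr_ge0.
move=> s s' z hs hs'; have [h1 h2] := hM s s' z hs hs'.
have [h3 h4] := hN s s' z hs hs';
have {}h5 : normc (h s' z) <= N * (1 + normc z) ^+ l by have [] := hN s' s z hs' hs.
have nn (x : C) := normc_ge0 x.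
have pk m : 0 <= (1 + normc z) ^+ m by rewrite exprn_ge0 // addr_ge0.
rewrite exprD; split.
  rewrite normcM; apply: le_trans (ler_pM (nn _) (nn _) h1 h3) _.
  have : 0 <= M * (1 + normc z) ^+ k * (N * (1 + normc z) ^+ l) by rewrite !mulr_ge0.
  by lra.
have -> : g s z * h s z - g s' z * h s' z =
    g s z * (h s z - h s' z) + (g s z - g s' z) * h s' z by ring.
rewrite (le_trans (le_normcD _ _)) // !normcM.
have e1 := ler_pM (nn _) (nn _) h1 h4.
have e2 := ler_pM (nn _) (nn _) h2 h5.
by apply: le_trans (lerD e1 e2) _; rewrite le_eqVlt; apply/orP; left; apply/eqP; ring.
Qed.

End ComplexEstimates.

Section Homotopy.
Context {R : realType} {n : nat}.
Local Notation C := R[i].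
Implicit Types (p : {mpoly C[n]}) (a b v : 'rV[C]_n).

(** A monomial of degree [d] is a product of [d] affine factors, each in [lip 1]; homogeneity gives
    all monomials the same weight. *)
Lemma lip_ev d p a b v : p \is d.-homog ->
  lip d (fun s z => ev p (a + s%:C%C *: b + z *: v)).
Proof.
move=> /dhomogP hp; suff : lip d (fun s z => \sum_(m <- msupp p) p@_m *
    \prod_i (a 0 i + s%:C%C * b 0 i + z * v 0 i) ^+ m i).
  congr lip; apply/funext => s; apply/funext => z; rewrite /ev mevalE.
  by apply: eq_bigr => m _; congr (_ * _); apply: eq_bigr => i _; rewrite !mxE.
pose G := fun r : seq 'X_{1..n} => fun s z => \sum_(m <- r) p@_m *
    \prod_i (a 0 i + s%:C%C * b 0 i + z * v 0 i) ^+ m i.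
rewrite -/(G (msupp p)).
have : forall m, m \in msupp p -> mdeg m = d by move=> m /hp.
elim: (msupp p) => [_|m r IH hr].
  exists 0; rewrite ?lexx // => s s' z _ _; rewrite /G !big_nil subrr normc0.
  by rewrite !mul0r lexx.
have -> : G (m :: r) = fun s z => (p@_m *
    \prod_i (a 0 i + s%:C%C * b 0 i + z * v 0 i) ^+ m i) + G r s z.
  by apply/funext => s; apply/funext => z; rewrite /G big_cons.
apply: lipD; last by apply: IH => x xr; apply: hr; rewrite inE xr orbT.
rewrite -(hr m (mem_head _ _)) -[mdeg m]add0n; apply: lipM; first exact: lipC.
rewrite mdegE.
elim: (index_enum _) => [|i l IHl].
  have -> : (fun s z => \prod_(i <- [::]) (a 0 i + s%:C%C * b 0 i + z * v 0 i) ^+ m i)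
    = fun _ _ => 1 by apply/funext => s; apply/funext => z; rewrite big_nil.
  by rewrite big_nil; exact: lipC.
rewrite big_cons.
have -> : (fun s z => \prod_(i <- i :: l) (a 0 i + s%:C%C * b 0 i + z * v 0 i) ^+ m i)
    = fun s z => (a 0 i + s%:C%C * b 0 i + z * v 0 i) ^+ m i *
       \prod_(i <- l) (a 0 i + s%:C%C * b 0 i + z * v 0 i) ^+ m i.
  by apply/funext => s; apply/funext => z; rewrite big_cons.
apply: lipM => //; elim: (m i) => [|k IHk].
  have -> : (fun s z => (a 0 i + s%:C%C * b 0 i + z * v 0 i) ^+ 0) = fun _ _ => 1.
    by apply/funext => s; apply/funext => z; rewrite expr0.
  exact: lipC.
have -> : (fun s z => (a 0 i + s%:C%C * b 0 i + z * v 0 i) ^+ k.+1) =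
   fun s z => (a 0 i + s%:C%C * b 0 i + z * v 0 i) *
      (a 0 i + s%:C%C * b 0 i + z * v 0 i) ^+ k.
  by apply/funext => s; apply/funext => z; rewrite exprS.
rewrite -add1n; apply: lipM => //; exact: lip_affine.
Qed.

Lemma line_split_complex d p a v : p \is d.-homog -> ev p v != 0 ->
  exists2 rs : seq C, size rs = d &
    line p a v = ev p v *: \prod_(z <- rs) ('X - z%:P).
Proof.
move=> hp v0; have [rs E] := closed_field_poly_normal (line p a v).
rewrite (lead_coef_line a hp v0) in E; exists rs => //.
have := size_line_eq a hp v0; rewrite E size_scale // size_prod_XsubC.
by case.
Qed.

(* The roots move continuously with s and never cross the real axis. *)
Lemma homotopy_roots d (F : R -> C -> C) c : c != 0 -> lip d F ->
    (forall s, exists2 rs : seq C, size rs = d &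
       forall z, F s z = c * \prod_(w <- rs) (z - w)) ->
    (forall (s t : R), 0 <= s <= 1 -> F s t%:C%C != 0) ->
    (forall z : C, 0 <= complex.Im z -> F 0 z != 0) ->
  forall z : C, 0 <= complex.Im z -> F 1 z != 0.
Proof.
move=> v0 [M M0 hM] fact nr good0.
pose good (s : R) := forall z : C, 0 <= complex.Im z -> F s z != 0.
rewrite -/(good 1).
have nv : 0 < normc c.
  by rewrite lt_neqAle normc_ge0 andbT; apply: contra_neq v0 => /esym/eq0_normc.
have root0 s rs z : (forall z, F s z = c * \prod_(w <- rs) (z - w)) -> z \in rs ->
    F s z = 0.
  by move=> -> zr; rewrite (big_rem z) //= subrr mul0r mulr0.
(* Openness: at a good [s] all roots lie below the real axis, and the growth of the product beats
   the Lipschitz change for all [z] at once. *)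
have opn s : 0 <= s <= 1 -> good s -> exists2 D, 0 < D & forall s', 0 <= s' <= 1 ->
    `|s - s'| < D -> good s'.
  move=> s01 gs; have [rs szr E] := fact s.
  have [|k k0 hk] := @normc_prod_growth _ rs.
    move=> w wr; rewrite ltNge; apply/negP => /gs.
    by rewrite (root0 _ _ _ E wr) eqxx.
  have M1 : 0 < M + 1 by rewrite ltr_wpDl.
  exists (normc c * k / (M + 1)); first by rewrite divr_gt0 ?mulr_gt0.
  move=> s' s'01; rewrite (ltr_pdivlMr _ _ M1) => ss' z z0.
  apply/eqP => e0; have [_] := hM s s' z s01 s'01.
  rewrite e0 subr0 E normcM; have := hk z z0; rewrite szr.
  have : 0 < (1 + normc z) ^+ d by rewrite exprn_gt0 // ltr_wpDr ?normc_ge0.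
  set B := (_ ^+ d); set P := normc (\prod_(_ <- _) _) => B0 kB h.
  have h1 : normc c * (k * B) <= normc c * P by rewrite ler_pM2l.
  have h2 : `|s - s'| * (M + 1) * B < normc c * k * B by rewrite ltr_pM2r.
  have h3 : 0 <= `|s - s'| * B by rewrite mulr_ge0 // ltW.
  by nra.
(* Closedness: a root [z] at time [s] has [Im z > 0]. Just before [s] all roots lie below the axis,
   which keeps the value at [z] above [|c| (Im z)^d], whereas the Lipschitz bound makes it small. *)
have cls s : 0 < s <= 1 -> (forall s', 0 <= s' < s -> good s') -> good s.
  move=> /andP[s0 s1] gs z z0; apply/eqP => e0.
  have b0 : 0 < complex.Im z.
    rewrite lt_neqAle z0 andbT; apply/eqP => /esym iz.
    have := nr s (complex.Re z); rewrite (ltW s0) s1 => /(_ isT).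
    by case: z {z0} e0 iz => x y /= e0 y0; move: e0; rewrite y0 => ->; rewrite eqxx.
  pose e := normc c * (complex.Im z) ^+ d.
  have e0' : 0 < e by rewrite mulr_gt0 ?exprn_gt0.
  pose B := (1 + normc z) ^+ d.
  have B0 : 0 < B by rewrite exprn_gt0 // ltr_wpDr ?normc_ge0.
  have MB : 0 < M * B + 1 by rewrite ltr_wpDl // mulr_ge0 // ltW.
  pose h := Num.min s (e / (2 * (M * B + 1))).
  have h0' : 0 < h by rewrite lt_min s0 divr_gt0 // mulr_gt0.
  have hs : h <= s by rewrite ge_min lexx.
  have hc : h * (2 * (M * B + 1)) <= e.
    by rewrite -ler_pdivlMr ?mulr_gt0 // ge_min lexx orbT.
  have s'b : 0 <= s - h < s by rewrite subr_ge0 hs ltrBlDr ltrDl.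
  have [rs szr E] := fact (s - h).
  have [||_] := hM (s - h) s z.
  - by case/andP: s'b => -> /ltW /le_trans ->.
  - by rewrite (ltW s0).
  rewrite e0 subr0 E normcM addrAC subrr sub0r normrN (gtr0_norm h0') -/B.
  have : e <= normc c * normc (\prod_(w <- rs) (z - w)).
    rewrite /e ler_pM2l // -szr; apply: normc_prod_ge => // w wr.
    have : complex.Im w < 0.
      rewrite ltNge; apply/negP => /(gs _ s'b).
      by rewrite (root0 _ _ _ E wr) eqxx.
    by case: (w) (z) => [? ?] [? ?] /= w0; rewrite lerDl oppr_ge0 ltW.
  move=> /le_trans h1 /h1.
  have := ltW MB; have := ltW h0'; nra.
(* Connectedness of [0, 1]: the supremum of the good initial segments is good by [cls], and by [opn]
   it cannot be below 1. *)
pose S : set R := [set s | 0 <= s <= 1 /\ forall s', 0 <= s' <= s -> good s'].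
have S0 : S 0.
  split; first by rewrite lexx ler01.
  by move=> s' /andP[a0 a1]; have -> : s' = 0 by apply/eqP; rewrite eq_le a0 a1.
have Sub : ubound S 1 by move=> x [/andP[]].
have hS : has_sup S by split; [exists 0 | exists 1].
have c0 : 0 <= sup S by apply: (sup_upper_bound hS).
have c1 : sup S <= 1 by apply: sup_le_ub => //; exists 0.
have below s' : 0 <= s' < sup S -> good s'.
  move=> /andP[s'0 s'c]; have [x Sx s'x] : exists2 x, S x & s' < x.
    have e0 : 0 < sup S - s' by rewrite subr_gt0.
    have [x Sx hx] := sup_adherent e0 hS; exists x => //.
    by move: hx; rewrite opprB addrC subrK.
  by apply: Sx.2; rewrite s'0 ltW.
have gc : good (sup S).
  have [c00|c00] := ltP 0 (sup S); first by apply: cls => //; rewrite c00.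
  by have -> : sup S = 0 by apply/eqP; rewrite eq_le c0 c00.
have [|D D0 hD] := opn (sup S) _ gc; first by rewrite c0 c1.
have [<- //|c1'] := eqVneq (sup S) 1.
have {}c1' : sup S < 1 by rewrite lt_neqAle c1' c1.
pose x := Num.min 1 (sup S + D / 2).
have cx : sup S < x by rewrite lt_min c1' ltrDl divr_gt0.
suff /(sup_upper_bound hS) : S x by rewrite leNgt cx.
have x1 : x <= 1 by rewrite ge_min lexx.
split; first by rewrite x1 andbT (le_trans c0) ?ltW.
move=> s' /andP[s'0 s'x]; have [sc|sc] := ltP s' (sup S).
  by apply: below; rewrite s'0.
apply: hD; first by rewrite s'0 (le_trans s'x).
rewrite distrC ger0_norm ?subr_ge0 // ltrBlDl.
apply: le_lt_trans s'x _; rewrite /x gt_min ltrD2l; apply/orP; right.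
by rewrite ltr_pdivrMr // mulr_natr mulr2n ltrDl.
Qed.

Lemma homotopy d p a b v : p \is d.-homog -> ev p v != 0 ->
    (forall (s t : R), 0 <= s <= 1 -> ev p (a + s%:C%C *: b + t%:C%C *: v) != 0) ->
    (forall z : C, 0 <= complex.Im z -> ev p (a + z *: v) != 0) ->
  forall z : C, 0 <= complex.Im z -> ev p (a + b + z *: v) != 0.
Proof.
move=> hp v0 nr h0 z z0.
have := @homotopy_roots d _ _ v0 (lip_ev a b v hp) _ nr _ z z0.
rewrite scale1r; apply.
  move=> s; have [rs hs E] := line_split_complex (a + s%:C%C *: b) hp v0.
  exists rs => // w; rewrite -horner_line E hornerZ horner_prod; congr (_ * _).
  by apply: eq_bigr => x _; rewrite hornerXsubC.
by move=> w /h0; rewrite scale0r addr0.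
Qed.

End Homotopy.

(** * Hyperbolicity cones *)

Section Garding.
Context {R : realType} {n : nat}.
Local Notation C := R[i].
Local Notation rc := (real_complex R).
Implicit Types (p : {mpoly R[n]}) (e u v x y : 'rV[R]_n).

Definition cvec x y : 'rV[C]_n := \row_j Complex (x 0 j) (y 0 j).

Definition evC p x y : C := ev (map_mpoly rc p) (cvec x y).

Lemma cvec_lin x y v (z : C) :
  cvec x y + z *: map_mx rc v =
  cvec (x + complex.Re z *: v) (y + complex.Im z *: v).
Proof.
apply/rowP => j; rewrite !mxE; case: z => a b /=.
by apply/eqP; rewrite eq_complex /= !(mulr0, subr0, add0r, addr0) !eqxx.
Qed.

Lemma cvec0 x : cvec x 0 = map_mx rc x.
Proof. by apply/rowP => j; rewrite !mxE. Qed.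

Lemma ev_map p x : ev (map_mpoly rc p) (map_mx rc x) = rc (ev p x).
Proof.
rewrite -(coef0_line _ (map_mx rc x) (map_mx rc x)) -map_line coef_map.
by rewrite coef0_line.
Qed.

Lemma evC0 p x : evC p x 0 = rc (ev p x).
Proof. by rewrite /evC cvec0 ev_map. Qed.

Lemma evCZ d p (z : C) x y : p \is d.-homog ->
  ev (map_mpoly rc p) (z *: cvec x y) = z ^+ d * evC p x y.
Proof. by move=> hp; rewrite (ev_homogZ _ _ (map_homog _ hp)). Qed.

Lemma evCZr d p (c : R) x y : p \is d.-homog ->
  evC p (c *: x) (c *: y) = rc c ^+ d * evC p x y.
Proof.
move=> hp; rewrite -(evCZ _ _ _ hp); congr ev.
apply/rowP => j; rewrite !mxE.
by apply/eqP; rewrite eq_complex /= !(mul0r, subr0, addr0) !eqxx.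
Qed.

Lemma evC_im d p y : p \is d.-homog -> ev p y = 0 -> evC p 0 y = 0.
Proof.
move=> hp y0; have -> : evC p 0 y = 'i%C ^+ d * evC p y 0.
  rewrite -(evCZ _ _ _ hp); congr ev; apply/rowP => j; rewrite !mxE.
  by apply/eqP; rewrite eq_complex /= !(mul0r, mul1r, subr0, addr0, add0r, oppr0) !eqxx.
by rewrite evC0 y0 mulr0.
Qed.

(** Hyperbolicity as the absence of zeros at the points [x + i e]; by homogeneity this excludes
    every nonreal root of [t |-> p(x + t e)]. *)
Definition hypd d p e :=
  [/\ p \is d.-homog, 0 < ev p e & forall x, evC p x e != 0].

(** The open cone, expressed by signs: for hyperbolic [p], no root of [p(x + t e)] at [t >= 0] means
    that all eigenvalues of [x] are positive. *)
Definition Gam p e x := forall t, 0 <= t -> 0 < ev p (x + t *: e).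

(** The closed cone in the same form; excluding [t = 0] admits boundary points. It is identified
    with [hyp_cone] in [hyp_coneE]. *)
Definition clo p e x := forall t, 0 < t -> 0 < ev p (x + t *: e).

Section Base.
Variables (d : nat) (p : {mpoly R[n]}) (e : 'rV[R]_n).
Hypothesis (H : hypd d p e).

Let hp : p \is d.-homog. Proof. by case: H. Qed.
Let e0 : 0 < ev p e. Proof. by case: H. Qed.

Lemma evC_hyp x (b : R) : b != 0 -> evC p x (b *: e) != 0.
Proof.
move=> b0; have -> : x = b *: (b^-1 *: x) by rewrite scalerA mulfV // scale1r.
rewrite (evCZr _ _ _ hp) mulf_neq0 ?expf_neq0 //; last by case: H.
by rewrite -(rmorph0 rc) (inj_eq (@complexI _)).
Qed.

Lemma hyp_split x : exists2 rs : seq R, size rs = d &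
  line p x e = ev p e *: \prod_(r <- rs) ('X - r%:P).
Proof.
have hpC : map_mpoly rc p \is d.-homog by exact: map_homog.
have eC : ev (map_mpoly rc p) (map_mx rc e) != 0.
  by rewrite ev_map -(rmorph0 rc) (inj_eq (@complexI _)) gt_eqF.
have [zs hs E] := line_split_complex (map_mx rc x) hpC eC.
exists [seq complex.Re z | z <- zs]; first by rewrite size_map.
apply: (map_poly_inj rc); rewrite map_line E map_polyZ ev_map; congr (_ *: _).
rewrite rmorph_prod big_map big_seq [RHS]big_seq.
apply: eq_bigr => z zr; rewrite rmorphB /= map_polyX map_polyC; congr ('X - _%:P).
have : (line (map_mpoly rc p) (map_mx rc x) (map_mx rc e)).[z] = 0.
  by rewrite E hornerZ horner_prod (big_rem z) //= hornerXsubC subrr mul0r mulr0.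
rewrite horner_line -cvec0 cvec_lin add0r -/(evC _ _ _).
have [iz _|/(evC_hyp _) /eqP h] := eqVneq (complex.Im z) 0; last by move/h.
by case: z iz {zr} => a b /= ->.
Qed.

Lemma hyp_roots x : exists2 rs : seq R, size rs = d &
  line p x e = ev p e *: \prod_(r <- rs) ('X - r%:P) /\
  forall t, (ev p (x + t *: e) == 0) = (t \in rs).
Proof.
have [rs hs E] := hyp_split x; exists rs => //; split=> // t.
rewrite -horner_line E hornerZ mulf_eq0 gt_eqF //=.
exact: root_prod_XsubC.
Qed.

Lemma clo_roots x rs : line p x e = ev p e *: \prod_(r <- rs) ('X - r%:P) ->
  (forall r, r \in rs -> r <= 0) -> clo p e x.
Proof.
move=> E h t t0; rewrite -horner_line E hornerZ horner_prod_XsubC mulr_gt0 //.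
rewrite big_seq prodr_gt0 // => r /h r0.
by rewrite subr_gt0 (le_lt_trans r0).
Qed.

Lemma clo_ne x : (forall t, 0 < t -> ev p (x + t *: e) != 0) -> clo p e x.
Proof.
move=> h; have [rs _ [E hr]] := hyp_roots x; apply: (clo_roots E) => r.
by rewrite -hr leNgt => h0; apply/negP => /h; rewrite h0.
Qed.

Lemma Gam_ne x : (forall t, 0 <= t -> ev p (x + t *: e) != 0) -> Gam p e x.
Proof.
move=> h; have [rs _ [E hr]] := hyp_roots x => t t0.
rewrite -horner_line E hornerZ horner_prod_XsubC mulr_gt0 //.
rewrite big_seq prodr_gt0 // => r; rewrite -hr => h0.
rewrite subr_gt0 (lt_le_trans _ t0) // ltNge; apply/negP => /h.
by rewrite h0.
Qed.

Lemma clo_line x : clo p e x -> nncoef (line p x e).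
Proof.
move=> h j; have [rs _ [E hr]] := hyp_roots x.
rewrite E coefZ mulr_ge0 ?(ltW e0) //; apply: prod_XsubC_coef_ge0 => r.
by rewrite -hr leNgt => h0; apply/negP => /h; rewrite (eqP h0) ltxx.
Qed.

Lemma Gam_line x j : Gam p e x -> (j <= d)%N -> 0 < (line p x e)`_j.
Proof.
move=> h jd; have [rs sz [E hr]] := hyp_roots x.
rewrite E coefZ mulr_gt0 //; apply: prod_XsubC_coef_gt0; rewrite ?sz // => r.
by rewrite -hr ltNge => h0; apply/negP => /h; rewrite (eqP h0) ltxx.
Qed.

Lemma Gam_clo x : Gam p e x -> clo p e x.
Proof. by move=> h t /ltW /h. Qed.

Lemma clo_Gam x t : clo p e x -> 0 < t -> Gam p e (x + t *: e).
Proof. by move=> h t0 s s0; rewrite -addrA -scalerDl h // ltr_wpDr. Qed.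

Lemma Gam_add x t : Gam p e x -> 0 <= t -> Gam p e (x + t *: e).
Proof. by move=> h t0 s s0; rewrite -addrA -scalerDl h // addr_ge0. Qed.

Lemma Gam_e : Gam p e e.
Proof.
move=> t t0; rewrite -{1}[e]scale1r -scalerDl (ev_homogZ _ _ hp) mulr_gt0 //.
by rewrite exprn_gt0 // ltr_wpDr.
Qed.

(** The roots on the line are finitely many and negative, hence bounded away from 0. This is the
    only openness that the homotopies for Garding's theorem use. *)
Lemma Gam_shift x : Gam p e x -> exists2 t, 0 < t & Gam p e (x - t *: e).
Proof.
move=> h; have [rs _ [E hr]] := hyp_roots x.
have [t t0 ht] : exists2 t, 0 < t & forall r, r \in rs -> r < - t.
  have : forall r, r \in rs -> r < 0.
    by move=> r; rewrite -hr ltNge => h0; apply/negP => /h; rewrite (eqP h0) ltxx.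
  elim: (rs) => [|r s IH] hs; first by exists 1.
  have [|t t0 ht] := IH; first by move=> y yr; rewrite hs // inE yr orbT.
  have r0 : r < 0 by rewrite hs // mem_head.
  exists (Num.min t (- r / 2)); first by rewrite lt_min t0 divr_gt0 // oppr_gt0.
  move=> y; rewrite inE ltrNr gt_min => /orP[/eqP ->|/ht].
    by apply/orP; right; lra.
  by rewrite ltrNr => ->.
exists t => //; apply: Gam_ne => s s0; rewrite -addrA -scaleNr -scalerDl hr.
by apply/negP => /ht; rewrite addrC ltrBlDr addNr ltNge s0.
Qed.

Lemma Gam_large x : exists2 t, 0 < t & Gam p e (x + t *: e).
Proof.
have [rs _ [E hr]] := hyp_roots x.
have [t t0 ht] : exists2 t, 0 < t & forall r, r \in rs -> r < t.
  elim: (rs) => [|r s [t t0 ht]]; first by exists 1.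
  exists (Num.max t (r + 1)); first by rewrite lt_max t0.
  move=> y; rewrite inE lt_max => /orP[/eqP ->|/ht -> //].
  by rewrite ltrDl ltr01 orbT.
exists t => //; apply: Gam_ne => s s0; rewrite -addrA -scalerDl hr.
by apply/negP => /ht; rewrite gtrDl ltNge s0.
Qed.

Lemma GamZ c x : 0 < c -> Gam p e x -> Gam p e (c *: x).
Proof.
move=> c0 h t t0; have -> : c *: x + t *: e = c *: (x + (t / c) *: e).
  by rewrite scalerDr scalerA mulrC divfK // gt_eqF.
by rewrite (ev_homogZ _ _ hp) mulr_gt0 ?exprn_gt0 // h // divr_ge0 // ltW.
Qed.

Lemma cloZ c x : 0 < c -> clo p e x -> clo p e (c *: x).
Proof.
move=> c0 h t t0; have -> : c *: x + t *: e = c *: (x + (t / c) *: e).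
  by rewrite scalerDr scalerA mulrC divfK // gt_eqF.
by rewrite (ev_homogZ _ _ hp) mulr_gt0 ?exprn_gt0 // h // divr_gt0.
Qed.

Lemma clo0 : clo p e 0.
Proof. by move=> t t0; rewrite add0r (ev_homogZ _ _ hp) mulr_gt0 // exprn_gt0. Qed.

(** The base point moves from [i a e] by [s (x + i y)], and [z] runs in direction [v]. For real [z]
    the imaginary part is [a e + s y], where the hypothesis on [y] excludes zeros; the conclusion is
    the value at [s = 1], [z = i b]. *)
Lemma garding_homotopy y v :
    (forall x a s, 0 < a -> 0 <= s <= 1 -> evC p x (a *: e + s *: y) != 0) ->
    Gam p e v ->
  forall x a b, 0 < a -> 0 <= b -> evC p x (a *: e + y + b *: v) != 0.
Proof.
move=> hy hv x a b a0 b0.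
have hpC : map_mpoly rc p \is d.-homog by exact: map_homog.
have pv : 0 < ev p v by have := hv 0 (lexx _); rewrite scale0r addr0.
have vC : ev (map_mpoly rc p) (map_mx rc v) != 0.
  by rewrite ev_map -(rmorph0 rc) (inj_eq (@complexI _)) gt_eqF.
have := @homotopy _ _ _ _ (cvec 0 (a *: e)) (cvec x y) _ hpC vC _ _ (Complex 0 b) b0.
have -> : cvec 0 (a *: e) + cvec x y = cvec x (a *: e + y).
  apply/rowP => j; rewrite !mxE.
  by apply/eqP; rewrite eq_complex /= add0r !eqxx.
rewrite cvec_lin /= scale0r addr0; apply => [s t s01|z z0].
  have -> : cvec 0 (a *: e) + rc s *: cvec x y = cvec (s *: x) (a *: e + s *: y).
    apply/rowP => j; rewrite !mxE.
    by apply/eqP; rewrite eq_complex /= !(mul0r, add0r, subr0, addr0) !eqxx.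
  by rewrite cvec_lin /= scale0r addr0; apply: hy.
have [->|zn0] := eqVneq z 0.
  by rewrite scale0r addr0; apply: evC_hyp; rewrite gt_eqF.
(* With [z] factored out, a zero would make [i a / z] a negative real root [r] of
   [t |-> p(v + t e)]; then [i a = r z] has imaginary part at most 0, against [a > 0]. *)
have -> : cvec 0 (a *: e) + z *: map_mx rc v =
    z *: (map_mx rc v + (Complex 0 a / z) *: map_mx rc e).
  rewrite scalerDr scalerA mulrC divfK // addrC; congr (_ + _).
  apply/rowP => j; rewrite !mxE.
  by apply/eqP; rewrite eq_complex /= !(mul0r, mulr0, add0r, subr0, addr0, oppr0) !eqxx.
rewrite (ev_homogZ _ _ hpC); apply: mulf_neq0; first exact: expf_neq0.
rewrite -horner_line -map_line.
have [rs _ [E hr]] := hyp_roots v.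
rewrite E map_polyZ hornerZ mulf_neq0 //.
  by rewrite -(rmorph0 rc) (inj_eq (@complexI _)) gt_eqF.
rewrite rmorph_prod horner_prod prodf_seq_neq0; apply/allP => r rr /=.
rewrite map_polyXsubC hornerXsubC subr_eq0; apply/eqP => h.
have r0 : r < 0.
  by move: rr; rewrite -hr ltNge => h0; apply/negP => /hv; rewrite (eqP h0) ltxx.
have : Complex 0 a = rc r * z by rewrite -h divfK.
case: z z0 {zn0 h} => c b' /= z0 [_]; rewrite mul0r addr0 => /eqP.
by rewrite gt_eqF // (le_lt_trans _ a0) // mulr_le0_ge0 // ltW.
Qed.

Lemma garding1 x a b v : Gam p e v -> 0 < a -> 0 <= b -> evC p x (a *: e + b *: v) != 0.
Proof.
move=> hv a0 b0; rewrite -[a *: e]addr0; apply: garding_homotopy => // y c s c0 _.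
by rewrite scaler0 addr0; apply: evC_hyp; rewrite gt_eqF.
Qed.

(** Second pass of the homotopy: [u - t e] is still in the open cone, so [garding1] covers the
    intermediate points [a e + s (u - t e)]. *)
Lemma garding2 x u v : Gam p e u -> Gam p e v -> evC p x (u + v) != 0.
Proof.
move=> hu hv; have [t t0 hut] := Gam_shift hu.
have -> : u + v = t *: e + (u - t *: e) + 1 *: v.
  by rewrite scale1r [t *: e + _]addrC subrK.
apply: garding_homotopy => // y a s a0 /andP[s0 _].
exact: garding1.
Qed.

Lemma hypd_Gam u : Gam p e u -> hypd d p u.
Proof.
move=> hu; split=> // [|x]; first by have := hu 0 (lexx _); rewrite scale0r addr0.
have [t t0 hut] := Gam_shift hu.
by have := garding1 x hut t0 ler01; rewrite scale1r addrC subrK.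
Qed.

(** A zero of [p] at [u + v + t e] would by homogeneity be one at [i (u + v + t e)], which
    [garding2] excludes. *)
Lemma GamD u v : Gam p e u -> Gam p e v -> Gam p e (u + v).
Proof.
move=> hu hv; apply: Gam_ne => t t0; apply/eqP; rewrite addrAC => h.
by have := garding2 0 (Gam_add hu t0) hv; rewrite (evC_im hp h) eqxx.
Qed.

Lemma Gam_sub u v : Gam p e u -> Gam p e v -> Gam p u v.
Proof.
move=> hu hv t; rewrite le_eqVlt => /orP[/eqP <-|t0].
  by rewrite scale0r addr0; have := hv 0 (lexx _); rewrite scale0r addr0.
have := GamD hv (GamZ t0 hu); move=> /(_ 0 (lexx _)).
by rewrite scale0r addr0.
Qed.

Lemma Gam_sym u : Gam p e u -> Gam p u e.
Proof. by move=> hu; apply: Gam_sub => //; exact: Gam_e. Qed.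

Lemma cloD_Gam x u : clo p e x -> Gam p e u -> Gam p e (x + u).
Proof.
move=> hx hu; have [t t0 hut] := Gam_shift hu.
by have := GamD (clo_Gam hx t0) hut; rewrite addrACA subrr addr0.
Qed.

Lemma cloD x y : clo p e x -> clo p e y -> clo p e (x + y).
Proof.
move=> hx hy t t0; have := cloD_Gam hx (clo_Gam hy t0).
by move=> /(_ 0 (lexx _)); rewrite scale0r addr0 addrA.
Qed.

Lemma clo_sub x u : Gam p e u -> clo p e x -> clo p u x.
Proof.
move=> hu hx t t0; have := cloD_Gam hx (GamZ t0 hu).
by move=> /(_ 0 (lexx _)); rewrite scale0r addr0.
Qed.

End Base.

(** Allows each differentiation step to be carried out with its own direction as base direction. *)
Lemma clo_base d p e x u : hypd d p e -> Gam p e u -> (clo p u x <-> clo p e x).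
Proof.
move=> H hu; split; last exact: (clo_sub H).
by apply: (clo_sub (hypd_Gam H hu)); apply: (Gam_sym H).
Qed.

End Garding.

(** * Derivatives and orders of vanishing *)

(** Gauss-Lucas at the point 0: the quotient is [f'(0) / f(0)], the sum of the [- 1 / w], and each
    term has negative imaginary part. *)
Lemma logderiv_Im_neg (R : realType) (rs : seq R[i]) (f := \prod_(w <- rs) ('X - w%:P)) :
    (forall w, w \in rs -> complex.Im w < 0) ->
  [/\ f`_0 != 0, complex.Im (f`_1 / f`_0) <= 0 &
      (0 < size rs)%N -> complex.Im (f`_1 / f`_0) < 0].
Proof.
rewrite /f {f}; elim: rs => [|w rs IH] h.
  by rewrite big_nil !coef1 mul0r; split; rewrite ?oner_eq0 ?raddf0 ?lexx.
have [|h0 h1 _] := IH; first by move=> z zr; apply: h; rewrite inE zr orbT.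
rewrite big_cons; set g := \prod_(_ <- _) _ in h0 h1 *.
have w0 : complex.Im w < 0 by rewrite h ?mem_head.
have wn0 : w != 0 by apply: contraTneq w0 => ->; rewrite ltxx.
have C0 : (('X - w%:P) * g)`_0 = - w * g`_0 by rewrite coef_XsubCM; ring.
have C1 : (('X - w%:P) * g)`_1 = g`_0 - w * g`_1 by rewrite coef_XsubCM.
have E : (('X - w%:P) * g)`_1 / (('X - w%:P) * g)`_0 = - w^-1 + g`_1 / g`_0.
  by rewrite C0 C1; field; rewrite wn0 h0.
have I : complex.Im (- w^-1 + g`_1 / g`_0) < 0.
  rewrite raddfD /= -[ltRHS](addr0 0) ltr_leD //.
  case: w w0 {wn0 h C0 C1 E} => a b /= b0; rewrite opprK pmulr_llt0 // invr_gt0.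
  by rewrite ltr_wpDl ?sqr_ge0 // exprn_even_gt0 //= lt_eqF.
by split; rewrite ?E ?ltW // C0 mulf_neq0 ?oppr_eq0.
Qed.

Section Derivatives.
Context {R : realType} {n : nat}.
Local Notation rc := (real_complex R).
Implicit Types (p : {mpoly R[n]}) (e u v w x y : 'rV[R]_n).

(** Order of vanishing at least [m] at [x], measured along [e]. On the closed cone the choice of
    direction in the open cone does not matter, by [van_base]. *)
Definition van p e x m := forall j, (j < m)%N -> (line p x e)`_j = 0.

Lemma evC_dirder p u x y :
  evC (dirder u p) x y = (line (map_mpoly rc p) (cvec x y) (map_mx rc u))`_1.
Proof.
rewrite coef1_line /evC dirderE /ev.
have -> : map_mpoly rc (\sum_i u 0 i *: p^`M(i)) =
    \sum_i (rc (u 0 i))%:MP * (map_mpoly rc p)^`M(i).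
  apply/mpolyP => m; rewrite mcoeff_map_mpoly !raddf_sum /=.
  apply: eq_bigr => i _.
  by rewrite mcoeffZ mcoeffCM rmorphM -map_mderiv mcoeff_map_mpoly.
rewrite (raddf_sum (meval _)); apply: eq_bigr => i _.
by rewrite /= mevalM mevalC !mxE.
Qed.

Section Cone.
Variables (d : nat) (p : {mpoly R[n]}) (e : 'rV[R]_n).
Hypotheses (H : hypd d p e).

Let hp : p \is d.-homog. Proof. by case: H. Qed.
Let e0 : 0 < ev p e. Proof. by case: H. Qed.

Lemma clo_ev_ge0 x : clo p e x -> 0 <= ev p x.
Proof. by move=> /(clo_line H) /(_ 0%N); rewrite coef0_line. Qed.

(** The restriction to the line through [x] in the hyperbolic direction [w] has nonnegative
    coefficients, hence increases from 0 to 1. *)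
Lemma Gam_mono x w : Gam p e x -> Gam p e w -> ev p x <= ev p (x + w).
Proof.
move=> hx hw; have Hw := hypd_Gam H hw.
have := nncoef_horner_ge 0 (clo_line Hw (Gam_clo (Gam_sub H hw hx))) ler01.
by rewrite coef0_line expr0 mulr1 horner_line scale1r.
Qed.

Lemma clo_mono x w : clo p e x -> clo p e w -> ev p x <= ev p (x + w).
Proof.
move=> hx hw; rewrite -subr_ge0.
have := @poly_ge0_limit _ (line p (x + w) (2 *: e) - line p x e).
rewrite coefB !coef0_line; apply => t t0.
rewrite hornerD hornerN !horner_line subr_ge0.
have -> : x + w + t *: (2 *: e) = (x + t *: e) + (w + t *: e).
  by rewrite addrACA -scalerDr -mulr2n scaler_nat.
by apply: Gam_mono; apply: (clo_Gam).
Qed.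

Lemma dirder_gt0 u x : (0 < d)%N -> Gam p e u -> Gam p e x -> 0 < ev (dirder u p) x.
Proof.
move=> d0 hu hx; rewrite ev_dirder.
exact: (Gam_line (hypd_Gam H hu) (Gam_sub H hu hx)).
Qed.

(** By Garding the roots [z] of [p(x + i e + z u)] all have negative imaginary part, so the
    logarithmic derivative at 0 cannot vanish. *)
Lemma hypd_dirder u : (0 < d)%N -> Gam p e u -> hypd d.-1 (dirder u p) e.
Proof.
move=> d0 hu; split; first exact: dirder_homog.
  by apply: dirder_gt0 => //; apply: (Gam_e H).
move=> x; rewrite evC_dirder.
have uC : ev (map_mpoly rc p) (map_mx rc u) != 0.
  rewrite ev_map -(rmorph0 rc) (inj_eq (@complexI _)) gt_eqF //.
  by have := hu 0 (lexx _); rewrite scale0r addr0.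
have [rs sz E] := line_split_complex (cvec x e) (map_homog rc hp) uC.
have [|h0 _ h1] := @logderiv_Im_neg _ rs.
  move=> z zr; rewrite ltNge; apply/negP => z0.
  have /eqP : (line (map_mpoly rc p) (cvec x e) (map_mx rc u)).[z] = 0.
    by rewrite E hornerZ horner_prod (big_rem z) //= hornerXsubC subrr mul0r mulr0.
  rewrite horner_line cvec_lin -/(evC _ _ _); apply/negP.
  by have := garding1 H (x + complex.Re z *: u) hu ltr01 z0; rewrite scale1r.
rewrite E coefZ mulf_neq0 //; apply/eqP => f1.
by have := h1; rewrite sz f1 mul0r ltxx => /(_ d0).
Qed.

Lemma Gam_dirder u x : (0 < d)%N -> Gam p e u -> Gam p e x -> Gam (dirder u p) e x.
Proof. by move=> d0 hu hx t t0; apply: dirder_gt0 => //; apply: Gam_add. Qed.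

Lemma clo_dirder u x : (0 < d)%N -> Gam p e u -> clo p e x -> clo (dirder u p) e x.
Proof.
move=> d0 hu hx t t0; have := dirder_gt0 d0 hu (clo_Gam hx t0) => //.
Qed.

(** Since [T e - u] lies in the cone, monotonicity gives [p(x + t u) <= p(x + t T e) = O(t^m)]. *)
Lemma van_base u x m : Gam p e u -> clo p e x -> van p e x m -> van p u x m.
Proof.
move=> hu hx hv; have hxu := clo_sub H hu hx.
have [T T0 hT] := Gam_large H (- u).
have [M M0 hM] := nncoef_horner_ub (clo_line H hx) (ltW T0) hv.
apply: (@nncoef_vanish _ _ _ (M * T ^+ m)).
  exact: (clo_line (hypd_Gam H hu)).
move=> t /andP[t0 t1]; rewrite horner_line -mulrA -exprMn.
have /hM : 0 <= T * t <= T by rewrite mulr_ge0 ?(ltW T0) ?(ltW t0) //= ler_piMr // ltW.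
apply: le_trans; rewrite horner_line.
have -> : x + (T * t) *: e = (x + t *: u) + t *: (- u + T *: e).
  by rewrite scalerDr scalerN addrA addrK scalerA [T * t]mulrC.
apply: clo_mono; last by apply: Gam_clo; apply: (GamZ H).
by apply: (cloD H) => //; apply: Gam_clo; apply: (GamZ H).
Qed.

Lemma van_dirder u x m : van p u x m.+1 -> van (dirder u p) u x m.
Proof. by move=> h j jm; rewrite -deriv_line_dirder coef_deriv h // mul0rn. Qed.

(** Subadditivity of the rank, one summand at a time. For [w = y + t e], [p] is affine in direction
    [x], so [p(w + x) = p(w) + D_x p(w)]; and [D_x p(w) <= K D_e p(w) = O(t^m)] because [K e - x] is
    in the open cone. *)
Lemma van_add x y m : (0 < d)%N -> clo p e x -> van p e x d.-1 ->
  clo p e y -> van p e y m.+1 -> van p e (y + x) m.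
Proof.
move=> d0 hx vx hy vy; have [K K0 hK] := Gam_large H (- x).
have De := hypd_dirder d0 (Gam_e H).
have hy' : clo (dirder e p) e y by apply: clo_dirder => //; apply: (Gam_e H).
have [M M0 hM] := nncoef_horner_ub (clo_line H hy) ler01 vy.
have [N N0 hN] := nncoef_horner_ub (clo_line De hy') ler01 (van_dirder vy).
apply: (@nncoef_vanish _ _ _ (M + K * N)).
  by apply: (clo_line H); apply: (cloD H).
move=> t /andP[t0 t1]; pose w := y + t *: e; have hw : Gam p e w by apply: clo_Gam.
have t01 : 0 <= t <= 1 by rewrite t1 ltW.
have vw := van_base hw hx vx.
(* For [j >= 2] the coefficient of [t^j] in [p(w + t x)] is that of [t^(d-j)] in [p(x + t w)], and
   [x] has order at least [d - 1]. *)
have E : ev p (w + x) = ev p w + ev (dirder x p) w.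
  have -> : w + x = w + 1 *: x by rewrite scale1r.
  rewrite -horner_line (horner_coef_wide _ (size_line w x hp)).
  have c2 j : (1 < j)%N -> (j <= d)%N -> (line p w x)`_j = 0.
    move=> j1 jd; rewrite (coef_line_rev _ _ hp jd) vw //.
    by rewrite -subn1 ltn_sub2l // (leq_trans j1).
  move: (d) d0 c2 => [//|d'] _ c2; rewrite !big_ord_recl big1 => [|i _].
    by rewrite expr0 expr1 !mulr1 addr0 coef0_line ev_dirder.
  by rewrite c2 ?mul0r //= /bump /= !add1n ltnS ltn_ord.
have hD : ev (dirder x p) w <= K * ev (dirder e p) w.
  have := dirder_gt0 d0 hK hw.
  rewrite ev_dirderD ev_dirderN (ev_dirderZ p w K e) addrC subr_gt0.
  exact: ltW.
rewrite horner_line addrAC -/w E mulrDl lerD //.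
  have := hM t t01; rewrite horner_line -/w => /le_trans; apply.
  by rewrite ler_wpM2l // exprS ler_piMl // exprn_ge0 // ltW.
apply: le_trans hD _; rewrite -mulrA ler_wpM2l ?(ltW K0) //.
by have := hN t t01; rewrite horner_line.
Qed.

End Cone.

(* If 0 were not a root, the Laguerre inequality would fail. *)
Lemma clo_dirder_van d p u x m : hypd d p u -> (0 < d)%N ->
    clo (dirder u p) u x -> (1 < m)%N -> van (dirder u p) u x m ->
  clo p u x /\ van p u x m.+1.
Proof.
move=> H d0 hx m1 hv; have D := hypd_dirder H d0 (Gam_e H).
have [rs sz E] := hyp_split H x.
have fS j : (line p x u)`_j.+1 *+ j.+1 = (line (dirder u p) x u)`_j.
  by rewrite -deriv_line_dirder coef_deriv.
have fm j : (j < m)%N -> (line p x u)`_j.+1 = 0.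
  by move=> /hv; rewrite -fS => /eqP; rewrite mulrn_eq0 /= => /eqP.
have f0 : (line p x u)`_0 = 0.
  case: rs sz E => [sz|r rs _ E]; first by rewrite -sz in d0.
  have [_] := laguerre_prod (r :: rs) (ev p u).
  rewrite -E => /(_ r (mem_head _ _)); rewrite /laguerre (fm _ m1) (fm 0 (ltnW m1)).
  rewrite mulr0 subr0 expr0n mulr0 => h.
  by apply/eqP; rewrite -sqrf_eq0 eq_le h sqr_ge0.
have nn : nncoef (line p x u).
  case=> [|j]; first by rewrite f0.
  by have := clo_line D hx j; rewrite -fS pmulrn_lge0.
split=> [t t0|[|j] //]; last exact: fm.
have := nncoef_horner_ge d nn (ltW t0).
have [hp p0 _] := H.
rewrite (lead_line _ _ hp) horner_line; apply: lt_le_trans.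
by rewrite mulr_gt0 // exprn_gt0.
Qed.

End Derivatives.

(** * Eigenvalues and topology of the cone *)

Section Eigenvalues.
Context {R : realType} {n : nat}.
Local Notation rc := (real_complex R).
Implicit Types (p : {mpoly R[n]}) (e u v w x y : 'rV[R]_n).

Lemma hyp_charpolyE p e x : hyp_charpoly p e x = line p (- x) e.
Proof.
rewrite /hyp_charpoly /line; congr mmap; apply/funext => i.
by rewrite mxE polyCN addrC.
Qed.

Lemma hyperbolic_hypd d p e : hyperbolic d p e -> hypd d p e.
Proof.
move=> [hp p0 hr]; split=> // x; apply/negP => /eqP x0.
have /eqP : complex.Im ('i%C : R[i]) = 0; last by rewrite /= oner_eq0.
apply: (hr (- x)); rewrite hyp_charpolyE opprK map_line rootE horner_line -cvec0.
by rewrite cvec_lin /= scale0r scale1r addr0 add0r -/(evC _ _ _) x0.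
Qed.

Section Cone.
Variables (d : nat) (p : {mpoly R[n]}) (e : 'rV[R]_n).
Hypotheses (H : hypd d p e).

Let hp : p \is d.-homog. Proof. by case: H. Qed.
Let e0 : 0 < ev p e. Proof. by case: H. Qed.

Lemma line_neq0 x : line p x e != 0.
Proof. by apply/eqP => h; move: e0; rewrite -(lead_line x e hp) h coef0 ltxx. Qed.

Lemma mem_hyp_eigenvalues x a :
  (a \in hyp_eigenvalues p e x) = (ev p (x - a *: e) == 0).
Proof.
have <- : root (line p (- x) e) a = (ev p (x - a *: e) == 0).
  rewrite rootE horner_line -[- x + _]opprK opprD opprK -scaleN1r.
  by rewrite (ev_homogZ _ _ hp) mulf_eq0 expf_eq0 oppr_eq0 oner_eq0 andbF.
have q0 := line_neq0 (- x).
rewrite /hyp_eigenvalues hyp_charpolyE.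
have rE (y : R) : (y \in rootsR (line p (- x) e)) = root (line p (- x) e) y.
  by rewrite -roots_on_rootsR.
apply/flatten_mapP/idP => [[y]|ra].
  by rewrite rE mem_nseq => ry /andP[_ /eqP ->].
exists a; first by rewrite rE.
by rewrite mem_nseq eqxx andbT -XsubC_dvd // dvdp_XsubCl.
Qed.

Lemma hyp_coneE : hyp_cone p e = [set x | clo p e x].
Proof.
apply/seteqP; split=> x h.
  apply: (clo_ne H) => t t0; apply/negP => h0.
  have := h (- t); rewrite mem_hyp_eigenvalues scaleNr opprK h0 => /(_ isT).
  by rewrite oppr_ge0 leNgt t0.
move=> a; rewrite mem_hyp_eigenvalues leNgt => /eqP h0; apply/negP => a0.
by have := h (- a); rewrite oppr_gt0 scaleNr h0 ltxx => /(_ a0).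
Qed.

(** With one nonzero eigenvalue [l] the characteristic polynomial is a multiple of
    [t^(d-1) (t - l)], so [p(x + t e) = O(t^(d-1))]. *)
Lemma hyp_rank1_van x : clo p e x -> hyp_rank p e x = 1%N -> van p e x d.-1.
Proof.
move=> hx; have [rs sz E] := hyp_split H (- x).
rewrite /hyp_rank; have /permP -> : perm_eq (hyp_eigenvalues p e x) rs.
  apply/allP => a _ /=; apply/eqP.
  have mE (y : R) : mup y (line p (- x) e) = count_mem y rs.
    by rewrite E -mul_polyC mupMr ?mu_prod_XsubC // rootC gt_eqF.
  rewrite /hyp_eigenvalues hyp_charpolyE count_flatten sumnE !big_map.
  have q0 := line_neq0 (- x).
  have rE (y : R) : (y \in rootsR (line p (- x) e)) = root (line p (- x) e) y.
    by rewrite -roots_on_rootsR.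
  have [ra|ra] := boolP (a \in rootsR (line p (- x) e)).
    rewrite (big_rem a) //= big_seq big1 => [|y].
      by rewrite addn0 count_nseq /= eqxx mul1n mE.
    rewrite mem_rem_uniq ?uniq_roots // inE => /andP[ya _].
    by rewrite count_nseq /= (negPf ya) mul0n.
  rewrite big_seq big1 => [|y ry].
    by rewrite -mE mupNroot // -rE.
  by rewrite count_nseq /=; case: eqP ry ra => // -> ->.
move=> c1.
have [l hl] : exists l, forall t, \prod_(r <- rs) (t - r) = t ^+ d.-1 * (t - l).
  move: c1; rewrite -sz; elim: (rs) => [//|r s IH] /=.
  have [->|r0] := eqVneq r 0.
    rewrite add0n => c1; have [l hl] := IH c1; exists l => t.
    rewrite big_cons hl subr0 mulrA -exprS prednK //.
    by have := count_size (fun a : R => a != 0) s; rewrite c1.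
  rewrite /= add1n => -[c0]; exists r => t; rewrite big_cons mulrC; congr (_ * _).
  elim: (s) c0 => [|r' s' IH'] /=; first by rewrite big_nil.
  by case: eqP => //= ->; rewrite add0n big_cons exprS subr0 => /IH' ->.
apply: (@nncoef_vanish _ _ _ (ev p e * (1 + `|l|))); first exact: (clo_line H).
move=> t /andP[t0 t1]; rewrite horner_line.
have -> : x + t *: e = -1 *: (- x + - t *: e).
  by rewrite scaleN1r opprD opprK scaleNr opprK.
rewrite (ev_homogZ _ _ hp) -horner_line E hornerZ horner_prod_XsubC hl.
apply: (le_trans (ler_norm _)).
rewrite !normrM !normrX !normrN normr1 expr1n mul1r (gtr0_norm e0).
rewrite -mulrA ler_wpM2l ?(ltW e0) // mulrC (gtr0_norm t0).
rewrite ler_wpM2r ?exprn_ge0 ?(ltW t0) // (le_trans (ler_normB _ _)) //.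
by rewrite normrN (gtr0_norm t0) lerD2r.
Qed.

End Cone.
End Eigenvalues.

(** * Topology of the cone, and tangent cones without closures *)

Section Topology.
Context {R : realType} {n : nat}.
Implicit Types (p : {mpoly R[n]}) (e u v w x y z : 'rV[R]_n).

Lemma nbhs_rowP x (B : set 'rV[R]_n) :
  nbhs x B <-> exists2 d : R, 0 < d &
    forall y : 'rV[R]_n, (forall j, `|y 0 j - x 0 j| < d) -> B y.
Proof.
rewrite nbhs_ballP; split=> -[d d0 h]; exists d => //.
  by move=> y hy; apply: h; split=> // i j; rewrite ord1 /ball /= distrC; exact: hy.
by move=> y [_ hy]; apply: h => j; move: (hy 0 j); rewrite /ball /= distrC.
Qed.

Lemma nbhs_along x e (B : set 'rV[R]_n) : nbhs x B ->
  exists2 t0 : R, 0 < t0 & forall t, `|t| <= t0 -> B (x + t *: e).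
Proof.
move=> /nbhs_rowP[d d0 h]; pose S := \sum_j `|e 0 j|.
have S0 : 0 < S + 1 by rewrite ltr_wpDl // sumr_ge0.
exists (d / (S + 1) / 2) => [|t ht]; first by rewrite !divr_gt0.
apply: h => j; rewrite !mxE addrAC subrr add0r normrM.
have hj : `|e 0 j| <= S by rewrite /S (bigD1 j) //= lerDl sumr_ge0.
have : `|t| * (S + 1) <= d / 2.
  by move: ht; rewrite mulrAC ler_pdivlMr.
have := normr_ge0 t; have := normr_ge0 (e 0 j); nra.
Qed.

Section Cone.
Variables (d : nat) (p : {mpoly R[n]}) (e : 'rV[R]_n).
Hypotheses (H : hypd d p e).

Lemma clo_sum (I : Type) (r : seq I) (F : I -> 'rV[R]_n) :
  (forall i, clo p e (F i)) -> clo p e (\sum_(i <- r) F i).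
Proof.
move=> h; apply: (big_ind (clo p e)) => //; first exact: (clo0 H).
exact: (cloD H).
Qed.

Lemma cloZ0 (c : R) x : 0 <= c -> clo p e x -> clo p e (c *: x).
Proof.
rewrite le_eqVlt => /orP[/eqP <- _|c0]; last exact: (cloZ H).
by rewrite scale0r; apply: (clo0 H).
Qed.

(** One [K] puts [K e] plus or minus every coordinate vector in the cone. A small [w] costs at most
    the multiple [K] times the sum of the [|w_j|] of [e], which the radius keeps below 1. *)
Lemma Gam_nbhs : exists2 D : R, 0 < D &
  forall w, (forall j, `|w 0 j| < D) -> Gam p e (e + w).
Proof.
have [K K0 hK] : exists2 K : R, 0 < K & forall j : 'I_n,
    clo p e (K *: e + delta_mx 0 j) /\ clo p e (K *: e - delta_mx 0 j).
  suff [K K0 hK] : exists2 K : R, 0 < K & forall j, j \in enum 'I_n ->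
      clo p e (K *: e + delta_mx 0 j) /\ clo p e (K *: e - delta_mx 0 j).
    by exists K => // j; apply: hK; rewrite mem_enum.
  elim: (enum 'I_n) => [|i s [K K0 hK]]; first by exists 1.
  have [a a0 ha] := Gam_large H (delta_mx 0 i : 'rV[R]_n).
  have [b b0 hb] := Gam_large H (- delta_mx 0 i : 'rV[R]_n).
  exists (K + a + b); first by rewrite !addr_gt0.
  have he c : 0 <= c -> clo p e (c *: e).
    by move=> c0; apply: cloZ0 => //; apply: Gam_clo; apply: (Gam_e H).
  have aux c v : clo p e (c *: e + v) -> c <= K + a + b ->
      clo p e ((K + a + b) *: e + v).
    move=> hv cK; rewrite -(subrK c (K + a + b)) scalerDl -addrA.
    by apply: (cloD H) => //; apply: he; rewrite subr_ge0.
  move=> j; rewrite inE => /orP[/eqP ->|/hK[h1 h2]].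
    split; [apply: (aux a) | apply: (aux b)]; try (by rewrite addrC; apply: Gam_clo).
      by rewrite addrAC lerDr addr_ge0 // ltW.
    by rewrite lerDr addr_ge0 // ltW.
  by split; apply: (aux K) => //; rewrite -addrA lerDl addr_ge0 // ltW.
exists (1 / (K * n%:R + 1)).
  by rewrite divr_gt0 // ltr_wpDl // mulr_ge0 // ltW.
move=> w hw.
have -> : e + w = (1 - \sum_j `|w 0 j| * K) *: e +
    \sum_j (`|w 0 j| *: (K *: e) + w 0 j *: delta_mx 0 j).
  rewrite big_split /= -row_sum_delta scalerBl scale1r -!addrA; congr (_ + _).
  rewrite addrA scaler_suml [X in - X](eq_bigr (fun j => `|w 0 j| *: (K *: e))).
    by rewrite addNr add0r.
  by move=> j _; rewrite scalerA.
rewrite addrC; apply: (cloD_Gam H).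
  apply: clo_sum => j; have [h1 h2] := hK j.
  have [w0|w0] := leP 0 (w 0 j).
    by rewrite (ger0_norm w0) -scalerDr; apply: cloZ0.
  have -> : `|w 0 j| *: (K *: e) + w 0 j *: delta_mx 0 j =
      - w 0 j *: (K *: e - delta_mx 0 j).
    by rewrite (ltr0_norm w0) scalerBr; congr (_ + _); rewrite scaleNr opprK.
  by apply: cloZ0 => //; rewrite oppr_ge0 ltW.
apply: (GamZ H); last exact: (Gam_e H).
rewrite subr_gt0.
have D0 : 0 < K * n%:R + 1 by rewrite ltr_wpDl // mulr_ge0 // ltW.
apply: (@le_lt_trans _ _ (\sum_(j < n) 1 / (K * n%:R + 1) * K)).
  by apply: ler_sum => j _; rewrite ler_wpM2r ?(ltW K0) // ltW.
rewrite sumr_const card_ord mul1r.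
have -> : (K * n%:R + 1)^-1 * K *+ n = K * n%:R / (K * n%:R + 1).
  by rewrite [in X in _ = X / _]mulr_natr mulrnAl [K / _]mulrC.
by rewrite ltr_pdivrMr // mul1r ltrDl.
Qed.

Lemma Gam_open (t : R) : 0 < t -> exists2 D : R, 0 < D &
  forall w, (forall j, `|w 0 j| < D) -> Gam p e (t *: e + w).
Proof.
move=> t0; have [D D0 h] := Gam_nbhs; exists (t * D); first by rewrite mulr_gt0.
move=> w hw; have -> : t *: e + w = t *: (e + t^-1 *: w).
  by rewrite scalerDr scalerA mulfV ?scale1r // gt_eqF.
apply: (GamZ H) => //; apply: h => j.
by rewrite mxE normrM gtr0_norm ?invr_gt0 // mulrC ltr_pdivrMr // mulrC.
Qed.

Lemma interior_Gam x : interior (hyp_cone p e) x -> Gam p e x.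
Proof.
rewrite (hyp_coneE H) => /(nbhs_along e)[t t0 h].
rewrite -(subrK (t *: e) x); apply: (clo_Gam _ t0).
by rewrite -scaleNr; apply: h; rewrite normrN gtr0_norm.
Qed.

Lemma hyp_cone_closed_convex : closed_convex_cone (hyp_cone p e).
Proof.
rewrite (hyp_coneE H); split.
- move=> x hx t t0; have [D D0 hD] := Gam_open t0.
  have [y [hy hxy]] : [set y | clo p e y] `&`
      [set y : 'rV[R]_n | forall j, `|y 0 j - x 0 j| < D] !=set0.
    by apply: hx; apply/nbhs_rowP; exists D.
  have /(_ 0 (lexx _)) : Gam p e (y + (t *: e + (x - y))).
    by apply: (cloD_Gam H) => //; apply: hD => j; rewrite !mxE distrC.
  by rewrite scale0r addr0 addrCA [y + _]addrC subrK addrC.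
- move=> x y l; rewrite !inE => hx hy; apply: (cloD H); apply: cloZ0 => //.
  by rewrite -[X in 0 <= X]/(1 - _) subr_ge0 le1.
- exact: (clo0 H).
- by move=> a x a0; apply: cloZ0.
Qed.

Lemma clo_shrink y w (s s' : R) : clo p e y -> 0 < s -> clo p e (y + s *: w) ->
  0 <= s' <= s -> clo p e (y + s' *: w).
Proof.
move=> hy s0 hw /andP[s'0 s's].
have -> : y + s' *: w = (1 - s' / s) *: y + (s' / s) *: (y + s *: w).
  rewrite scalerDr addrA -scalerDl subrK scale1r scalerA divfK //.
  by rewrite gt_eqF.
apply: (cloD H); apply: cloZ0 => //; last by rewrite divr_ge0 // ltW.
by rewrite subr_ge0 ler_pdivrMr // mul1r.
Qed.

(** The closure is absorbed by the interior direction: a point of the conic hull near [z] differs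
    from [z] by a vector that [t e] pulls into the cone. *)
Lemma tangent_coneP y z : clo p e y ->
  tangent_cone (hyp_cone p e) y z <->
  forall t : R, 0 < t -> exists2 s : R, 0 < s & clo p e (y + s *: (z + t *: e)).
Proof.
move=> hy; rewrite (hyp_coneE H); split=> [hz t t0|hz B /(nbhs_along e)[t t0 ht]].
  have [D D0 hD] := Gam_open t0.
  have [w [[m [a [c [hac ->]]]] hw]] :
      conic_hull [set c - y | c in [set x | clo p e x]] `&`
      [set w : 'rV[R]_n | forall j, `|w 0 j - z 0 j| < D] !=set0.
    by apply: hz; apply/nbhs_rowP; exists D.
  set W := \sum_(i < m) _ in hw.
  pose S := \sum_(i < m) a i.
  have S0 : 0 <= S by rewrite sumr_ge0 // => i _; case: (hac i).
  (* Scaling by the total weight [S] leaves the nonnegative weight [1 - s S] for [y], so a conic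
     combination of differences becomes a point of the cone. *)
  pose s := (S + 1)^-1; have s0 : 0 < s by rewrite invr_gt0 ltr_wpDl.
  exists s => //.
  have -> : y + s *: (z + t *: e) = (y + s *: W) + s *: (t *: e + (z - W)).
    rewrite -addrA -scalerDr; congr (_ + _ *: _).
    by rewrite addrCA [W + _]addrC subrK addrC.
  apply: (cloD H); last first.
    by apply: cloZ0 (ltW s0) _; apply: Gam_clo; apply: hD => j; rewrite !mxE distrC; exact: hw.
  have -> : y + s *: W = (1 - s * S) *: y + \sum_(i < m) (s * a i) *: (c i + y).
    have -> : \sum_(i < m) (s * a i) *: (c i + y) = s *: W + (s * S) *: y.
      rewrite scaler_sumr mulr_sumr scaler_suml -big_split /=.
      by apply: eq_bigr => i _; rewrite scalerDr scalerA.
    by rewrite addrCA -scalerDl subrK scale1r addrC.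
  apply: (cloD H).
    apply: cloZ0 => //; rewrite subr_ge0 mulrC ler_pdivrMr ?mul1r ?lerDl //.
    by rewrite ltr_wpDl.
  apply: clo_sum => i; have [a0 [x hx <-]] := hac i.
  by rewrite subrK; apply: cloZ0 => //; rewrite mulr_ge0 // ltW.
have [s s0 hs] := hz t t0; exists (z + t *: e); split; last first.
  by apply: ht; rewrite gtr0_norm.
exists 1%N, (fun=> s^-1), (fun=> s *: (z + t *: e)); split=> [_|]; last first.
  by rewrite big_ord1 scalerA mulVf ?scale1r // gt_eqF.
split; first by rewrite invr_ge0 ltW.
by exists (y + s *: (z + t *: e)) => //; rewrite addrC addKr.
Qed.

End Cone.
End Topology.

(** * Tangent cones *)

Lemma poly_coef1_ge0 (R : realFieldType) (f : {poly R}) : f`_0 = 0 ->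
  (forall t, 0 < t <= 1 -> 0 <= f.[t]) -> 0 <= f`_1.
Proof.
move=> f0 h; rewrite leNgt; apply/negP => f1.
have [||t t0 ht] := @poly_gt0_right _ (- f); rewrite ?coefN ?f0 ?oppr0 ?oppr_gt0 //.
have m0 : 0 < Num.min 1 t by rewrite lt_min ltr01.
have := ht (Num.min 1 t); rewrite m0 ge_min lexx orbT => /(_ isT).
by rewrite hornerN oppr_gt0 ltNge h // m0 ge_min lexx.
Qed.

(** Termwise comparison [j <= d]; at a root [r] it bounds [- f(0)] from below by [r f'(r) / d]. *)
Lemma deriv_horner_le (R : realFieldType) d (f : {poly R}) r : (size f <= d.+1)%N ->
    (forall j, 0 <= f`_j.+1) -> 0 <= r ->
  r * f^`().[r] <= d%:R * (f.[r] - f`_0).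
Proof.
move=> sf f0 r0.
have sf' : (size f^`() <= d)%N.
  have [->|fn0] := eqVneq f 0; first by rewrite deriv0 size_poly0.
  by rewrite -ltnS (leq_trans (lt_size_deriv fn0)).
rewrite (horner_coef_wide _ sf) (horner_coef_wide _ sf') big_ord_recl expr0 mulr1.
rewrite addrC addKr !mulr_sumr; apply: ler_sum => i _.
rewrite coef_deriv lift0 exprS -[f`_i.+1 *+ _]mulr_natr.
have -> : r * (f`_i.+1 * i.+1%:R * r ^+ i) = i.+1%:R * (f`_i.+1 * (r * r ^+ i)) by ring.
by rewrite ler_wpM2r ?ler_nat // !mulr_ge0 // exprn_ge0.
Qed.

Section Tangent.
Context {R : realType} {n : nat}.
Implicit Types (p : {mpoly R[n]}) (e u v w x y z : 'rV[R]_n).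

(** The tangent cone at [y] in the closure-free form of [tangent_coneP]. *)
Definition tang p e y z :=
  forall t : R, 0 < t -> exists2 s : R, 0 < s & clo p e (y + s *: (z + t *: e)).

Lemma Gam_perturb d p e y z : hypd d p e -> Gam p e y ->
  exists2 s0 : R, 0 < s0 & forall s, 0 <= s <= s0 -> Gam p e (y + s *: z).
Proof.
move=> H hy; have [a a0 ha] := Gam_shift H hy; have [K K0 hK] := Gam_large H z.
exists (a / K) => [|s /andP[s0 sK]]; first by rewrite divr_gt0.
have -> : y + s *: z = (y - a *: e) + (s *: (z + K *: e) + (a - s * K) *: e).
  rewrite scalerDr scalerA -[s *: z + _ + _]addrA -scalerDl [s * K + _]addrC subrK.
  by rewrite [s *: z + _]addrC addrA subrK.
rewrite addrC; apply: (cloD_Gam H) => //; apply: (cloD H); apply: (cloZ0 H) => //.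
- exact: Gam_clo.
- by rewrite subr_ge0 -ler_pdivlMr.
- exact: (Gam_clo (Gam_e H)).
Qed.

Section Cone.
Variables (d : nat) (p : {mpoly R[n]}) (e : 'rV[R]_n).
Hypotheses (H : hypd d p e).

Let hp : p \is d.-homog. Proof. by case: H. Qed.

Lemma convex_tangent_spaceP y z : clo p e y ->
  convex_tangent_space (hyp_cone p e) y z <-> tang p e y z /\ tang p e y (- z).
Proof.
move=> hy; split=> [[/(tangent_coneP H _ hy) h1 [w hw E]]|[h1 h2]].
  by split=> //; apply/(tangent_coneP H _ hy); rewrite -E opprK.
split; first exact/(tangent_coneP H _ hy).
by exists (- z); [exact/(tangent_coneP H _ hy) | rewrite opprK].
Qed.

Lemma tang_small y z t : clo p e y -> tang p e y z -> 0 < t ->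
  exists2 s0 : R, 0 < s0 & forall s, 0 <= s <= s0 -> clo p e (y + s *: (z + t *: e)).
Proof.
move=> hy hz /hz[s0 s00 h]; exists s0 => // s hs.
exact: (clo_shrink H hy s00 h).
Qed.

Lemma tang_base u y z : Gam p e u -> tang p e y z -> tang p u y z.
Proof.
move=> hu hz t t0; have [a a0 ha] := Gam_shift H hu.
have [s s0 hs] := hz (t * a) (mulr_gt0 t0 a0); exists s => //.
apply/(clo_base _ H hu).
have -> : y + s *: (z + t *: u) =
    (y + s *: (z + (t * a) *: e)) + (s * t) *: (u - a *: e).
  rewrite -addrA -[(s * t) *: _]scalerA -scalerDr -addrA -scalerA -scalerDr.
  by rewrite addrC [a *: e + _]addrC subrK addrC.
by apply: (cloD H) => //; apply: (cloZ H); [exact: mulr_gt0 | exact: Gam_clo].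
Qed.

Lemma tang_clo_add y w z : clo p e w -> tang p e y z -> tang p e (w + y) z.
Proof.
move=> hw hz t /hz[s s0 hs]; exists s => //.
by rewrite -addrA; apply: (cloD H).
Qed.

Lemma tang0 y : clo p e y -> tang p e y 0.
Proof.
move=> hy t t0; exists 1 => //; rewrite add0r scale1r.
exact: Gam_clo (clo_Gam hy t0).
Qed.

Lemma tangD y z z' : clo p e y -> tang p e y z -> tang p e y z' -> tang p e y (z + z').
Proof.
move=> hy hz hz' t t0; have t2 : 0 < t / 2 by rewrite divr_gt0.
have [s s0 hs] := tang_small hy hz t2; have [s' s'0 hs'] := tang_small hy hz' t2.
pose r := Num.min s s'; have r0 : 0 < r by rewrite lt_min s0.
exists (r / 2); first by rewrite divr_gt0.
have -> : y + (r / 2) *: (z + z' + t *: e) =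
    2^-1 *: ((y + r *: (z + (t / 2) *: e)) + (y + r *: (z' + (t / 2) *: e))).
  rewrite addrACA -scalerDr addrACA -scalerDl -splitr [RHS]scalerDr scalerA.
  have -> : y + y = 2 *: y by rewrite scaler_nat mulr2n.
  by rewrite mulrC scalerA mulVf ?scale1r ?pnatr_eq0.
apply: (cloZ H); first by rewrite invr_gt0.
by apply: (cloD H); [apply: hs | apply: hs']; rewrite (ltW r0) ge_min lexx ?orbT.
Qed.

Lemma tang_sum y (I : Type) (r : seq I) (F : I -> 'rV[R]_n) : clo p e y ->
  (forall i, tang p e y (F i)) -> tang p e y (\sum_(i <- r) F i).
Proof.
move=> hy h; apply: (big_ind (tang p e y)) => //; first exact: tang0.
by move=> a b; apply: tangD.
Qed.

Lemma Gam_tang y z : Gam p e y -> tang p e y z.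
Proof.
move=> hy t t0; have [s s0 hs] := Gam_perturb (z + t *: e) H hy.
by exists s => //; apply: Gam_clo; apply: hs; rewrite lexx ltW.
Qed.

Lemma clo_tang_scale y c : clo p e y -> tang p e y (c *: y).
Proof.
move=> hy t t0; pose s := (`|c| + 1)^-1.
have c0 : 0 < `|c| + 1 by rewrite ltr_wpDl.
have s0 : 0 < s by rewrite invr_gt0.
exists s => //; have -> : y + s *: (c *: y + t *: e) = (1 + s * c) *: y + (s * t) *: e.
  by rewrite scalerDr !scalerA addrA scalerDl scale1r.
apply: (cloD H); apply: (cloZ0 H) => //; last exact: (Gam_clo (Gam_e H)).
  have : s * (`|c| + 1) = 1 by rewrite mulVf // gt_eqF.
  by have := lerNnormlW (lexx `|c|); nra.
by rewrite mulr_ge0 // ltW.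
Qed.

(** * Boundary points of multiplicity one, where the differential supports the cone *)

Section Smooth.
Variable (y : 'rV[R]_n).
Hypotheses (hy : clo p e y) (y0 : ev p y = 0) (y1 : 0 < (line p y e)`_1).

Let phi z := ev (dirder z p) y.

Let phi_ge0 z : (forall t, 0 < t <= 1 -> 0 <= ev p (y + t *: z)) -> 0 <= phi z.
Proof.
move=> h; rewrite /phi ev_dirder; apply: poly_coef1_ge0; first by rewrite coef0_line.
by move=> t /h; rewrite horner_line.
Qed.

Lemma smooth_clo z : clo p e z -> 0 <= ev (dirder z p) y.
Proof.
move=> hz; apply: phi_ge0 => t /andP[t0 _]; apply: (clo_ev_ge0 H).
by apply: (cloD H) => //; apply: (cloZ H).
Qed.

(** Euler's identity in inequality form: [p] vanishes on the segment from [y] to 0, which gives the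
    sign opposite to that of [smooth_clo]. *)
Lemma smooth_self : ev (dirder y p) y = 0.
Proof.
apply/eqP; rewrite eq_le smooth_clo // andbT -oppr_ge0 -ev_dirderN.
apply: phi_ge0 => t _; rewrite scalerN -{1}[y]scale1r -scalerBl.
by rewrite (ev_homogZ _ _ hp) y0 mulr0.
Qed.

Lemma smooth_tang_ge0 x z : ev (dirder x p) y = 0 -> tang p e x z ->
  0 <= ev (dirder z p) y.
Proof.
move=> x0 hz; rewrite leNgt; apply/negP => z0.
have e1 : 0 < ev (dirder e p) y by rewrite ev_dirder.
(* With this [t] the functional takes half of its negative value on [z + t e], yet it is nonnegative
   on the cone and zero at [x]. *)
have [|s s0 /smooth_clo] := hz (- ev (dirder z p) y / (2 * ev (dirder e p) y)).
  by rewrite divr_gt0 ?oppr_gt0 // mulr_gt0.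
rewrite ev_dirderD x0 add0r ev_dirderZ pmulr_rge0 //.
rewrite ev_dirderD ev_dirderZ.
have -> : - ev (dirder z p) y / (2 * ev (dirder e p) y) * ev (dirder e p) y =
    - ev (dirder z p) y / 2 by field; rewrite gt_eqF.
by lra.
Qed.

(* y lies in the open cone of D_e p, so p is increasing along e near y. *)
Lemma smooth_tang z : (0 < d)%N -> ev (dirder z p) y = 0 -> tang p e y z.
Proof.
move=> d0 z0 t t0; have D := hypd_dirder H d0 (Gam_e H).
have yD : Gam (dirder e p) e y.
  move=> s s0; rewrite -horner_line.
  have := nncoef_horner_ge 0 (clo_line D (clo_dirder H d0 (Gam_e H) hy)) s0.
  by rewrite expr0 mulr1; apply: lt_le_trans; rewrite coef0_line ev_dirder.
have [a a0 ha] := Gam_perturb z D yD.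
have [||b b0 hb] := @poly_gt0_right _ (line p y (z + t *: e)).
- by rewrite coef0_line.
- by rewrite -ev_dirder ev_dirderD ev_dirderZ z0 add0r mulr_gt0 // ev_dirder.
pose s := Num.min a b; have s0 : 0 < s by rewrite lt_min a0.
exists s => // r r0.
have F0 : 0 < (line p (y + s *: z) e).[s * t].
  rewrite horner_line -addrA -scalerA -scalerDr -horner_line hb // s0.
  by rewrite ge_min lexx orbT.
have -> : y + s *: (z + t *: e) + r *: e = (y + s *: z) + (s * t + r) *: e.
  by rewrite scalerDr scalerDl scalerA !addrA.
rewrite -horner_line; apply: (lt_le_trans F0); apply: nncoef_horner_le.
  case=> // j _; have := clo_line D (Gam_clo (ha s _)) j.
  rewrite -deriv_line_dirder coef_deriv pmulrn_lge0 //; apply.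
  by rewrite (ltW s0) ge_min lexx.
by rewrite mulr_ge0 ?(ltW s0) ?(ltW t0) //= lerDl ltW.
Qed.

End Smooth.
End Cone.
End Tangent.

(** * Tangent spaces of a derivative cone at points of multiplicity at least two *)

Section Renegar.
Context {R : realType} {n : nat}.
Implicit Types (p q : {mpoly R[n]}) (e u v w x y z : 'rV[R]_n).

Lemma nncoef_order (f : {poly R}) d : nncoef f -> 0 < f`_d ->
  f`_0 = 0 -> f`_1 = 0 ->
  exists m, [/\ (1 < m)%N, 0 < f`_m & forall j, (j < m)%N -> f`_j = 0].
Proof.
move=> hf fd f0 f1.
have ex : exists m, 0 < f`_m by exists d.
case: (ex_minnP ex) => m fm hm; exists m; split=> // [|j jm].
  by case: m fm {hm} => [|[|m]] //; rewrite ?f0 ?f1 ltxx.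
apply/eqP; rewrite eq_le hf andbT leNgt; apply/negP => /hm.
by rewrite leqNgt jm.
Qed.

(* With sigma the scale of f near 0, the Laguerre inequality forbids a root of
   f that is large compared with sigma. *)
Lemma root_le_scale d m (k K sg r : R) (f : {poly R}) rs c :
    (0 < d)%N -> (size f <= d.+1)%N -> (1 < m)%N -> 0 < k -> 0 <= K -> 0 < sg ->
    f = c *: \prod_(r <- rs) ('X - r%:P) -> r \in rs -> f.[r] = 0 ->
    (forall j, 0 <= f`_j.+1) ->
    (forall t, 0 <= t -> k * t ^+ m <= f^`().[t]) ->
    f`_1 <= K * sg ^+ m -> 2 * f`_2 <= K * sg ^+ m.-1 ->
  r <= (1 + 2 * K * d%:R / k) * sg.
Proof.
move=> d0 sf m1 k0 K0 sg0 E rr fr f0 lo up1 up2.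
have dR : 0 < d%:R :> R by rewrite ltr0n.
set N := 1 + _; have N1 : 1 <= N.
  by rewrite lerDl divr_ge0 ?(ltW k0) // !mulr_ge0 // ltW.
have N0 : 0 < N by apply: lt_le_trans N1.
(* If [r > N sg], then [B = - f(0)] is at least [k r^(m+1) / d], while [r f_1] and [2 r^2 f_2] are
   at most [K r^(m+1) / N <= B / 2]. The Laguerre inequality would give
   [B^2 <= B^2 / 4 + B^2 / 2]. *)
rewrite leNgt; apply/negP => rN.
have r0 : 0 < r by apply: lt_trans rN; rewrite mulr_gt0.
have sr : sg <= r / N by rewrite ler_pdivlMr // mulrC ltW.
have sgpow j : (0 < j)%N -> sg ^+ j <= r ^+ j / N.
  move=> j0; apply: (@le_trans _ _ ((r / N) ^+ j)).
    by rewrite lerXn2r ?nnegrE ?divr_ge0 ?(ltW sg0) ?(ltW r0) ?(ltW N0).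
  rewrite expr_div_n ler_wpM2l ?exprn_ge0 ?(ltW r0) //.
  rewrite lef_pV2 ?posrE ?exprn_gt0 //.
  by rewrite -[leLHS]expr1 ler_weXn2l.
pose X := r ^+ m.+1; have X0 : 0 < X by rewrite exprn_gt0.
pose B := - f`_0.
have dB : k * X <= d%:R * B.
  have := deriv_horner_le sf f0 (ltW r0); rewrite fr sub0r -/B; apply: le_trans.
  by rewrite /X exprS mulrCA ler_wpM2l ?(ltW r0) // lo // ltW.
have B0 : 0 < B by rewrite -(pmulr_rgt0 _ dR) (lt_le_trans _ dB) // mulr_gt0.
pose h := K / N.
have h0 : 0 <= h by rewrite divr_ge0 // ltW.
have hX : 2 * (h * X) <= B.
  rewrite -(ler_pM2l dR); apply: le_trans dB.
  have -> : d%:R * (2 * (h * X)) = (2 * K * d%:R / N) * X by rewrite /h; field; rewrite gt_eqF.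
  rewrite ler_wpM2r ?(ltW X0) // ler_pdivrMr //.
  have -> : k * N = k + 2 * K * d%:R by rewrite /N; field; rewrite gt_eqF.
  by rewrite lerDr ltW.
have e1 : r * f`_1 <= h * X.
  apply: (@le_trans _ _ (r * (K * (r ^+ m / N)))).
    by rewrite ler_wpM2l ?(ltW r0) // (le_trans up1) // ler_wpM2l // sgpow // ltnW.
  by rewrite /h /X exprS le_eqVlt; apply/orP; left; apply/eqP; ring.
have e2 : r ^+ 2 * (2 * f`_2) <= h * X.
  apply: (@le_trans _ _ (r ^+ 2 * (K * (r ^+ m.-1 / N)))).
    rewrite ler_wpM2l ?exprn_ge0 ?(ltW r0) // (le_trans up2) // ler_wpM2l // sgpow //.
    by rewrite -subn1 subn_gt0.
  have -> : X = r ^+ 2 * r ^+ m.-1 by rewrite -exprD add2n prednK // ltnW.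
  by rewrite /h le_eqVlt; apply/orP; left; apply/eqP; ring.
have e3 : 0 <= r * f`_1 by rewrite mulr_ge0 // ltW.
have [_ /(_ r rr)] := laguerre_prod rs c; rewrite -E /laguerre.
have -> : f`_0 = - B by rewrite opprK.
have -> : r ^+ 2 * (f`_1 ^+ 2 - 2 * - B * f`_2) =
    (r * f`_1) ^+ 2 + B * (r ^+ 2 * (2 * f`_2)) by ring.
move: (r * f`_1) (r ^+ 2 * (2 * f`_2)) (h * X) hX e1 e2 e3 => a b g hg ag bg a0.
rewrite sqrrN => hB.
have aB : a ^+ 2 <= (B / 2) ^+ 2 by rewrite lerXn2r ?nnegrE //; lra.
have bB : B * b <= B * (B / 2) by rewrite ler_wpM2l ?(ltW B0) //; lra.
by nra.
Qed.

(** Let [b = y + s (z + ep u)] and let [m] be the order of [q] at [y]. Monotonicity of [q] squeezes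
    [q(b + c u)] between multiples of [c^m] and, for small arguments, [(s ep + c / 2)^m]. Then
    [root_le_scale] bounds the roots of [r |-> p(b + r u)] by [N s ep], so [b + N s ep u] lies in
    the cone of [p]. *)
Lemma tang_dirder d p u y z : hypd d p u -> (0 < d)%N ->
    clo (dirder u p) u y -> van (dirder u p) u y 2 ->
    tang (dirder u p) u y z -> tang (dirder u p) u y (- z) ->
  tang p u y z.
Proof.
move=> H d0; set q := dirder u p => hy hv hz hz' t t0.
have [hp _ _] := H.
have D : hypd d.-1 q u by apply: hypd_dirder => //; exact: (Gam_e H).
have [hq q0 _] := D.
pose Q := line q y u; have nQ : nncoef Q by exact: (clo_line D hy).
have [m [m1 km Qm]] : exists m,
    [/\ (1 < m)%N, 0 < Q`_m & forall j, (j < m)%N -> Q`_j = 0].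
  apply: (nncoef_order nQ (d := d.-1)); [|exact: hv|exact: hv].
  by rewrite /Q (lead_line _ _ hq).
have [M M0 hM] := nncoef_horner_ub nQ ler01 Qm.
pose a : R := 2 ^+ d.-1; have a0 : 0 < a by rewrite exprn_gt0.
pose k := Q`_m / a; have k0 : 0 < k by rewrite divr_gt0.
pose K := a * M * 2 ^+ m; have K0 : 0 <= K by rewrite !mulr_ge0 // ltW.
pose N := 1 + 2 * K * d%:R / k.
have N0 : 0 < N.
  apply: ltr_wpDr => //; apply: divr_ge0 (ltW k0).
  by apply: mulr_ge0 => //; apply: mulr_ge0.
have N10 : 0 < N + 1 by apply: addr_gt0.
(* As [N] does not depend on [ep], the given [t] can be split: [ep] to enter the cone of [q], and
   [N ep] to pass the roots of [p]. *)
pose ep := t / (N + 1); have ep0 : 0 < ep by exact: divr_gt0.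
have tE : t = N * ep + ep by rewrite /ep; field; rewrite gt_eqF.
have [s1 s10 hs1] := tang_small D hy hz ep0.
have [s2 s20 hs2] := tang_small D hy hz' ep0.
(* The steps [2 s] along [z] and [s] along [- z] must be admissible, and [2 sg <= 1] keeps the
   arguments in the range of [hM]. *)
pose s := Num.min (Num.min (s1 / 2) s2) (1 / (2 * ep)).
have s0 : 0 < s by rewrite !lt_min !divr_gt0 // ?s20 // mulr_gt0.
have ss1 : 2 * s <= s1.
  by rewrite mulrC -ler_pdivlMr // /s !ge_min lexx.
have ss2 : s <= s2 by rewrite /s !ge_min lexx orbT.
pose sg := s * ep; have sg0 : 0 < sg by rewrite mulr_gt0.
have sg1 : 2 * sg <= 1.
  have : s <= 1 / (2 * ep) by rewrite /s !ge_min lexx !orbT.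
  have ep2 : 0 < 2 * ep by apply: mulr_gt0.
  by rewrite (ler_pdivlMr _ _ ep2) => h; rewrite /sg mulrCA.
pose b := y + s *: (z + ep *: u).
have hb : clo q u b by apply: hs1; rewrite (ltW s0) /=; lra.
have hb2 : clo q u (y + (2 * s) *: (z + ep *: u)) by apply: hs1; rewrite ss1 andbT mulr_ge0 // ltW.
have hb' : clo q u (y + s *: (- z + ep *: u)) by apply: hs2; rewrite ss2 ltW.
have hu c : 0 <= c -> clo q u (c *: u).
  by move=> c0; apply: (cloZ0 D) => //; apply: Gam_clo; apply: (Gam_e D).
pose f := line p b u; have df : f^`() = line q b u by rewrite deriv_line_dirder.
have nf : nncoef f^`() by rewrite df; exact: (clo_line D hb).
have f0 j : 0 <= f`_j.+1 by have := nf j; rewrite coef_deriv pmulrn_lge0.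
(* Adding the cone point with [- z] cancels [z], leaving twice a point on the line through [y] in
   direction [u]. *)
have up c : 0 <= c -> sg + c / 2 <= 1 -> f^`().[c] <= a * M * (sg + c / 2) ^+ m.
  move=> c0 c1; rewrite df horner_line.
  have := clo_mono D (cloD D hb (hu c c0)) hb'.
  have -> : b + c *: u + (y + s *: (- z + ep *: u)) = 2 *: (y + (sg + c / 2) *: u).
    by apply/rowP => j; rewrite /b /sg !mxE; field.
  rewrite (ev_homogZ _ _ hq) -/a -(horner_line q y u) -/Q => /le_trans; apply.
  rewrite -mulrA; apply: ler_wpM2l; first exact: ltW.
  apply: hM; rewrite c1 andbT; apply: addr_ge0; first exact: ltW.
  by apply: divr_ge0.
(* [b + c u] is the sum of half of [y + 2 c u] and half of a cone point, so [q] is at least its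
   value at the first half. *)
have lo c : 0 <= c -> k * c ^+ m <= f^`().[c].
  move=> c0; rewrite df horner_line.
  have h1 : clo q u (2^-1 *: (y + (2 * c) *: u)).
    apply: (cloZ D); rewrite ?invr_gt0 //; apply: (cloD D) => //.
    by apply: hu; rewrite mulr_ge0.
  have h2 : clo q u (2^-1 *: (y + (2 * s) *: (z + ep *: u))).
    by apply: (cloZ D); rewrite ?invr_gt0.
  have := clo_mono D h1 h2.
  have -> : 2^-1 *: (y + (2 * c) *: u) + 2^-1 *: (y + (2 * s) *: (z + ep *: u)) =
      b + c *: u.
    by apply/rowP => j; rewrite /b !mxE; field.
  apply: le_trans; rewrite (ev_homogZ _ _ hq) -(horner_line q y u) -/Q exprVn -/a.
  have -> : k * c ^+ m = a^-1 * (Q`_m * c ^+ m) by rewrite /k mulrAC mulrC.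
  apply: ler_wpM2l; first by rewrite invr_ge0 ltW.
  have c2 : 0 <= 2 * c by rewrite mulr_ge0.
  apply: le_trans (nncoef_horner_ge m nQ c2).
  by rewrite ler_wpM2l ?(ltW km) // lerXn2r ?nnegrE //; lra.
have up1 : f`_1 <= K * sg ^+ m.
  have := up 0 (lexx _); rewrite mul0r addr0 horner_coef0 coef_deriv mulr1n.
  have sgm : 0 <= sg ^+ m by rewrite exprn_ge0 // ltW.
  move=> /(_ _)/le_trans; apply; first by lra.
  apply: ler_wpM2r => //; rewrite /K ler_peMr //; first by rewrite mulr_ge0 // ltW.
  by rewrite exprn_ege1 // ler1n.
(* Evaluate [up] at [c = 2 sg], where the bound is exactly [K sg^m]; the linear term of [f'] alone
   lies below it. *)
have up2 : 2 * f`_2 <= K * sg ^+ m.-1.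
  rewrite -(ler_pM2r sg0).
  have c0 : 0 <= 2 * sg by lra.
  have := up (2 * sg) c0; rewrite mulrC mulKf ?pnatr_eq0 // -mulr2n.
  have -> : sg *+ 2 = 2 * sg by rewrite mulr_natl.
  move=> /(_ sg1) h; have := le_trans (nncoef_horner_ge 1 nf c0) h.
  rewrite coef_deriv expr1 exprMn [a * M * (_ * _)]mulrA -/K -[f`_2 *+ 2]mulr_natl.
  have -> : sg ^+ m = sg ^+ m.-1 * sg by rewrite -exprSr prednK // ltnW.
  have := mulr_ge0 (f0 1%N) (ltW sg0).
  by move: (sg ^+ m.-1) => w; nra.
exists s => //; apply: (clo_ne H) => t' t'0; apply/negP.
have -> : y + s *: (z + t *: u) + t' *: u = b + (N * sg + t') *: u.
  by apply/rowP => j; rewrite /b /sg tE !mxE; ring.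
have [rs sz [E hr]] := hyp_roots H b; move=> h0.
have fr : f.[N * sg + t'] = 0 by rewrite horner_line (eqP h0).
rewrite hr in h0.
have := root_le_scale d0 (size_line b u hp) m1 k0 K0 sg0 E h0 fr f0 lo up1 up2.
by rewrite -/N gerDl leNgt t'0.
Qed.

End Renegar.

(** * Iterated derivatives *)

Section Iterate.
Context {R : realType} {n : nat}.
Implicit Types (p q : {mpoly R[n]}) (e u v w x y z : 'rV[R]_n) (s : seq 'rV[R]_n).

Lemma iter_hypd d p e s : hypd d p e -> (size s <= d)%N ->
    (forall u, u \in s -> Gam p e u) ->
  hypd (d - size s) (iter_dirder s p) e /\
  forall x, clo p e x -> clo (iter_dirder s p) e x.
Proof.
elim: s d p => [|u s IH] d p H sd hs; first by rewrite subn0.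
have d0 : (0 < d)%N by apply: leq_trans sd.
have hu : Gam p e u by apply: hs; rewrite mem_head.
have [||h1 h2] := IH d.-1 (dirder u p) (hypd_dirder H d0 hu).
- by rewrite -ltnS prednK.
- by move=> v vs; apply: (Gam_dirder H) => //; apply: hs; rewrite inE vs orbT.
rewrite /= -[(d - _)%N](_ : (d.-1 - size s = _)%N); last first.
  by rewrite -subn1 -subnDA add1n.
by split=> // x hx; apply: h2; apply: (clo_dirder H).
Qed.

(** [van_dirder] differentiates along the base direction, so the base is moved to [u] and back by
    [van_base]. *)
Lemma iter_van d p e s y m : hypd d p e -> (size s <= d)%N ->
    (forall u, u \in s -> Gam p e u) -> clo p e y ->
  van p e y (m + size s) -> van (iter_dirder s p) e y m.
Proof.
elim: s d p => [|u s IH] d p H sd hs hy; first by rewrite addn0.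
have d0 : (0 < d)%N by apply: leq_trans sd.
have hu : Gam p e u by apply: hs; rewrite mem_head.
have D := hypd_dirder H d0 hu.
rewrite /= addnS => hv; apply: (IH d.-1 (dirder u p) D).
- by rewrite -ltnS prednK.
- by move=> v vs; apply: (Gam_dirder H) => //; apply: hs; rewrite inE vs orbT.
- exact: (clo_dirder H).
have Du := hypd_Gam D (Gam_dirder H d0 hu hu).
apply: (van_base Du); first exact: (Gam_sym D (Gam_dirder H d0 hu hu)).
  exact: (clo_sub D (Gam_dirder H d0 hu hu) (clo_dirder H d0 hu hy)).
by apply: van_dirder; apply: (van_base H).
Qed.

(** The derivatives are undone from the last to the first. The multiplicity grows by one each time,
    so it stays at least 2, as [clo_dirder_van] and [tang_dirder] require. *)
Lemma iter_back d p e s y m : hypd d p e -> (size s <= d)%N ->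
    (forall u, u \in s -> Gam p e u) -> (1 < m)%N ->
    clo (iter_dirder s p) e y -> van (iter_dirder s p) e y m ->
  [/\ clo p e y, van p e y (m + size s) &
    forall z, tang (iter_dirder s p) e y z -> tang (iter_dirder s p) e y (- z) ->
      tang p e y z].
Proof.
move=> H sd hs m1; elim: s d p H sd hs => [|u s IH] d p H sd hs.
  by rewrite addn0 => hy hv; split.
have d0 : (0 < d)%N by apply: leq_trans sd.
have hu : Gam p e u by apply: hs; rewrite mem_head.
have D := hypd_dirder H d0 hu; have Hu := hypd_Gam H hu.
have Du := Gam_dirder H d0 hu hu.
rewrite /= => hy hv; have [||//|//|h1 h2 h3] := IH d.-1 (dirder u p) D.
- by rewrite -ltnS prednK.
- by move=> v vs; apply: (Gam_dirder H) => //; apply: hs; rewrite inE vs orbT.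
have c1 := clo_sub D Du h1; have v1 := van_base D Du h1 h2.
have m2 : (1 < m + size s)%N by rewrite ltn_addr.
have [c2 v2] := clo_dirder_van Hu d0 c1 m2 v1.
have eu := Gam_sym H hu; have c3 : clo p e y by apply/(clo_base _ H hu).
split=> // [|z hz hz']; first by rewrite addnS; apply: (van_base Hu).
apply: (tang_base Hu eu); apply: (tang_dirder Hu d0 c1).
- by move=> j j2; apply: v1; apply: leq_trans m2.
- by apply: (tang_base D Du); apply: h3.
- by apply: (tang_base D Du); apply: h3; rewrite ?opprK.
Qed.

(** The origin has order [d], and by [van_add] each rank-one summand costs at most one. *)
Lemma van_sum d p e k (x : 'I_k -> 'rV[R]_n) : hypd d p e -> (0 < d)%N ->
    (forall i, clo p e (x i)) -> (forall i, van p e (x i) d.-1) -> (k <= d)%N ->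
  van p e (\sum_(i < k) x i) (d - k).
Proof.
move=> H d0; have [hp p0 _] := H; elim: k x => [|k IH] x hc hv kd.
  rewrite big_ord0 subn0; apply: (@nncoef_vanish _ _ _ (ev p e)).
    exact: (clo_line H (clo0 H)).
  move=> t _; rewrite horner_line add0r (ev_homogZ _ _ hp) mulrC //.
rewrite big_ord_recr /=; apply: (van_add H d0) => //.
  by apply: (clo_sum H) => i; apply: hc.
rewrite subnSK //; apply: IH => //.
exact: ltnW.
Qed.

End Iterate.

(** * Tangent spaces at sums of extreme rays of the derivative cone *)

Theorem theorem5p14 (R : realType) (n d : nat) (p : {mpoly R[n]})
    (e : 'rV[R]_n) (hp : hyperbolic d p e) (hd : (3 < d)%N)
    (hpointed : pointed (hyp_cone p e))
    (hterracini : terracini_convex (hyp_cone p e))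
    (hrank : forall x : 'rV[R]_n,
       extreme_ray_generator (hyp_cone p e) x -> hyp_rank p e x = 1%N)
    (l : nat) (hl : (1 <= l <= d - 3)%N)
    (u : l.-tuple 'rV[R]_n)
    (hu : forall i : 'I_l, hyp_open_cone p e (tnth u i)) :
  k_terracini_convex (d - l - 2) (hyp_cone (iter_dirder u p) e).
Proof.
have H := hyperbolic_hypd hp.
have d0 : (0 < d)%N by apply: ltn_trans hd.
have ld : (l <= d - 3)%N by case/andP: hl.
have l3 : (l + 3 <= d)%N by lia.
have hs v : v \in (u : seq _) -> Gam p e v.
  by move=> /tnthP[i ->]; apply: (interior_Gam H); exact: hu.
have sd : (size u <= d)%N by rewrite size_tuple; lia.
have [Q pq] := iter_hypd H sd hs.
have back y m := @iter_back _ _ d p e u y m H sd hs.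
have fwd y m := @iter_van _ _ d p e u y m H sd hs.
move: Q pq back fwd; rewrite size_tuple; set q := iter_dirder u p => Q pq back fwd.
have Cp := hyp_coneE H; have Cq := hyp_coneE Q.
have m0 : (0 < d - l)%N by lia.
have [hq q0 _] := Q.
split; first exact: (hyp_cone_closed_convex Q).
  apply/seteqP; split=> x; last first.
    move=> ->; rewrite Cq; split; first exact: (clo0 Q).
    by exists 0; rewrite ?oppr0 //; exact: (clo0 Q).
  (* Pointedness: [q] has order [d - l >= 3] at 0 and the tangent cone at 0 is the cone itself, so
     [back] at 0 carries a line in the cone of [q] into the pointed cone of [p]. *)
  rewrite Cq => -[hx [x' hx' xE]].
  have v0 : van q e 0 (d - l).
    by have := @van_sum _ _ _ q e 0 (fun=> 0) Q m0; rewrite big_ord0 subn0; apply=> // -[].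
  have [] := back 0 2%N isT (clo0 Q).
    by move=> j j2; apply: v0; lia.
  move=> _ _ back0.
  have ct w : clo q e w -> tang q e 0 w.
    move=> hw t t0; exists 1 => //; rewrite add0r scale1r.
    exact: (Gam_clo (clo_Gam hw t0)).
  have c0 w : tang p e 0 w -> clo p e w.
    move=> hw t t0; have [|s s0] := hw (t / 2); first by rewrite divr_gt0.
    have si : 0 < s^-1 by rewrite invr_gt0.
    have t2 : 0 < t / 2 by rewrite divr_gt0.
    rewrite add0r => /(cloZ H si)/(_ _ t2).
    by rewrite scalerA mulVf ?gt_eqF // scale1r -addrA -scalerDl -splitr.
  have xE' : x' = - x by rewrite -xE opprK.
  rewrite xE' in hx'.
  have hx1 : clo p e x by apply: c0; apply: back0; apply: ct.
  have hx2 : clo p e (- x) by apply: c0; apply: back0; rewrite ?opprK; apply: ct.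
  rewrite -hpointed Cp; split=> //; exists (- x) => //; exact: opprK.
set k := (d - l - 2)%N => x hx.
have cx i : clo q e (x i) by case: (hx i); rewrite Cq.
have cS : clo q e (\sum_(i < k) x i) by apply: (clo_sum Q).
have ctsP y z := convex_tangent_spaceP Q (y := y) z.
have tS i z : tang q e (x i) z -> tang q e (\sum_(j < k) x j) z.
  move=> hz; rewrite (bigD1 i) //= addrC; apply: (tang_clo_add Q) => //.
  by rewrite -big_filter; apply: (clo_sum Q).
apply/seteqP; split=> w; last first.
  move=> [z hz ->]; apply/ctsP => //; rewrite -sumrN.
  have hz' i : tang q e (x i) (z i) /\ tang q e (x i) (- z i) by apply/ctsP.
  by split; apply: (tang_sum Q) => // i; apply: (tS i); case: (hz' i).
move=> /(ctsP _ _ cS)[hw hw'].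
(* If [w] already lies in one of the tangent spaces, the other summands are taken to be 0. *)
have single i w' : tang q e (x i) w' -> tang q e (x i) (- w') -> w = w' ->
    minkowski_sum (fun i => convex_tangent_space (hyp_cone q e) (x i)) w.
  move=> h1 h2 ->; exists (fun j => if j == i then w' else 0).
    move=> j; apply/ctsP => //; case: eqP => [->|_]; first by split.
    by rewrite oppr0; split; exact: (tang0 (cx j)).
  by rewrite (bigD1 i) //= eqxx big1 ?addr0 // => j /negPf ->.
have [allv|] := pselect (forall i, van q e (x i) 2).
  have cp i : clo p e (x i) by have [] := back (x i) 2%N isT (cx i) (allv i).
  (* The cone of [q] contains that of [p], so a ray that is a face of the larger cone and lies in
     the smaller one is a face there too. *)
  have ext i : extreme_ray_generator (hyp_cone p e) (x i).
    have [_ xn0 hf] := hx i; split=> //; first by rewrite Cp; exact: cp.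
    by move=> y z; rewrite Cp => hy hz; apply: hf; rewrite Cq; apply: pq.
  have vp i : van p e (x i) d.-1 by apply: (hyp_rank1_van H) => //; apply: hrank.
  have kd : (k <= d)%N by rewrite /k; lia.
  have vS : van q e (\sum_(i < k) x i) 2.
    apply: fwd; first exact: (clo_sum H).
    (* The value of [k] is tight here: [k] rank-one summands leave order [d - k = 2 + l] for [p],
       and [l] derivatives leave 2. *)
    have -> : (2 + l = d - k)%N.
      by rewrite /k; lia.
    exact: (van_sum H).
  have [cSp _ tSp] := back _ 2%N isT cS vS.
  have k0 : (0 < k)%N by rewrite /k; lia.
  have [_ _ hT] := hterracini k k0.
  have : convex_tangent_space (hyp_cone p e) (\sum_(i < k) x i) w.
    by apply/(convex_tangent_spaceP H) => //; split; apply: tSp => //; rewrite opprK.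
  rewrite hT // => -[z hz ->]; exists z => // i.
  apply/ctsP => //; have /(convex_tangent_spaceP H _ (cp i))[h1 h2] := hz i.
  by split=> t /[dup] t0; [move=> /h1|move=> /h2] => -[s s0 /pq]; exists s.
move=> /existsNP[i hi].
(* Multiplicity 0 means that [x i] is in the open cone, where every direction is tangent. *)
have [y0|y0] := eqVneq (ev q (x i)) 0; last first.
  have hG : Gam q e (x i).
    move=> t; rewrite le_eqVlt => /orP[/eqP <-|/(cx i)//].
    by rewrite scale0r addr0 lt_neqAle eq_sym y0 (clo_ev_ge0 Q).
  by apply: (single i w) => //; apply: (Gam_tang Q).
have y1 : 0 < (line q (x i) e)`_1.
  rewrite lt_neqAle (clo_line Q) // andbT; apply/eqP => y1; apply: hi.
  by case=> [_|[_|//]] //; rewrite coef0_line.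
pose phi z := ev (dirder z q) (x i).
have phiN z : phi (- z) = - phi z by exact: ev_dirderN.
have ker z : phi z = 0 -> tang q e (x i) z.
  exact: (smooth_tang Q (cx i) y0 y1 m0).
have phi_e : 0 < phi e by rewrite /phi ev_dirder.
(* If all generators lie in the supporting hyperplane at [x i], so does their sum. The functional is
   then nonnegative on the tangent cone at the sum, hence zero at [w], and [w] is tangent at
   [x i]. *)
have [all0|] := pselect (forall j, phi (x j) = 0).
  have phiS : phi (\sum_(j < k) x j) = 0.
    rewrite /phi; apply: (big_ind (fun y => ev (dirder y q) (x i) = 0)).
    - by rewrite -[0](scale0r 0) ev_dirderZ mul0r.
    - by move=> a b ha hb; rewrite ev_dirderD ha hb addr0.
    - by move=> j _; apply: all0.
  have ge0 z : tang q e (\sum_(j < k) x j) z -> 0 <= phi z.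
    exact: (smooth_tang_ge0 Q (cx i) y0 y1).
  have w0 : phi w = 0.
    by apply/eqP; rewrite eq_le ge0 // andbT -oppr_ge0 -phiN ge0.
  by apply: (single i w) => //; apply: ker; rewrite ?phiN w0 ?oppr0.
move=> /existsNP[j /eqP hj].
have ij : j != i by apply: contra_neq hj => ->; exact: (smooth_self Q (cx i) y0).
(* Otherwise some [x j] is off the hyperplane. The line through [x j] lies in its own tangent space,
   and this multiple corrects [w] into the kernel of [phi]. *)
pose c := phi w / phi (x j).
have w'0 : phi (w - c *: x j) = 0.
  by rewrite /phi ev_dirderD ev_dirderN ev_dirderZ -/(phi _) -/(phi _) /c divfK // subrr.
exists (fun a => if a == i then w - c *: x j else if a == j then c *: x j else 0).
  move=> a; apply/ctsP => //; case: eqP => [->|_].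
    by split; apply: ker; rewrite ?phiN w'0 ?oppr0.
  case: eqP => [->|_]; last by rewrite oppr0; split; exact: (tang0 (cx a)).
  by split; rewrite -?scaleNr; apply: (clo_tang_scale Q).
rewrite (bigD1 i) //= eqxx (bigD1 j) //= (negPf ij) eqxx big1 ?addr0 ?subrK //.
by move=> a /andP[/negPf -> /negPf ->].
Qed.
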